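(* Let $q\in\mathbb{N}$ and let $a=(a_n)_{n\in\mathbb{Z}}$ and $b=(b_n)_{n\in\mathbb{Z}}$ be bounded sequences of nonzero scalars. Suppose that, for all $i,j\in\mathbb{Z}$, $$\lim_{n\to\infty}|a_1a_2\cdots a_{(n+r)^q-r^q+i}\,b_1b_2\cdots b_{(n+r)^q-r^q+j}|=\infty$$ and $$\lim_{n\to\infty}|a_ia_{i-1}\cdots a_{i-r^q+(r-n)^q+1}\,b_jb_{j-1}\cdots b_{j-r^q+(r-n)^q+1}|=0,$$ uniformly in $r\in\mathbb{N}_0$. Then $C_{T_a,S_b}$ is $q$-frequently hypercyclic on $(\mathcal{L}(\ell^1(\mathbb{Z})),\mathrm{SOT})$, and on $(\mathcal{K}(\ell^p(\mathbb{Z})),\|\cdot\|_{op})$ and $(\mathcal{L}(\ell^p(\mathbb{Z})),\mathrm{COT})$ for $1<p<\infty$.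
   Context: $\mathbb{N}=\{1,2,\dots\}$, $\mathbb{N}_0=\mathbb{N}\cup\{0\}$. With $\{e_n\}_{n\in\mathbb{Z}}$ the standard basis of $\ell^p(\mathbb{Z})$, the bilateral backward shift $T_a$ and forward shift $S_b$ are $T_a(e_n)=a_ne_{n-1}$ and $S_b(e_n)=b_ne_{n+1}$, $n\in\mathbb{Z}$. $C_{R,T}$ is the map $C_{R,T}(S)=RST$. $\mathcal{L}(X)$ and $\mathcal{K}(X)$ are the bounded and compact operators on $X$; SOT is the strong operator topology, COT the topology of uniform convergence on compact sets, $\|\cdot\|_{op}$ the operator norm. In the first limit, the products are considered for $n$ large enough (depending on $i,j$ only) that the final indices are $\ge1$. The second limit concerns the range $n\le r$ and means: for every $\varepsilon>0$ there is $N$ such that for all $r\in\mathbb{N}_0$ and all $n$ with $N\le n\le r$ the quantity is less than $\varepsilon$ (each of the two products has $r^q-(r-n)^q$ factors, with decreasing indices). A continuous linear operator $A$ on a topological vector space $E$ is $q$-frequently hypercyclic if there is $x\in E$ such that for every non-empty open $V\subset E$ the set $M=\{n\in\mathbb{N}: A^nx\in V\}$ satisfies $\liminf_{N\to\infty}\frac{\mathrm{card}\{n\in M:\ n\le N^q\}}{N}>0$. *)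

(* Defs.v *)
From HB Require Import structures.
From mathcomp Require Import all_boot all_order all_algebra.
From mathcomp Require Import all_classical all_reals all_analysis.
From mathcomp.real_closed Require Import complex.
From mathcomp Require Import ring.

Set Implicit Arguments.
Unset Strict Implicit.
Unset Printing Implicit Defensive.

Import Order.TTheory GRing.Theory Num.Theory numFieldNormedType.Exports.

Local Open Scope classical_set_scope.
Local Open Scope ring_scope.

(* "Scalars" are real or complex; both cases are handled at once. *)
Variant scalar_kind := RealScalars | ComplexScalars.

Definition scalar_field (R : realType) (k : scalar_kind) : numFieldType :=
  match k with RealScalars => R | ComplexScalars => R[i] end.

Definition to_scalar (R : realType) (k : scalar_kind) : R -> scalar_field R k :=
  match k return R -> scalar_field R k with
  | RealScalars => fun x => x
  | ComplexScalars => fun x => (x%:C)%C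
  end.
Arguments to_scalar {R k}.

(* MathComp's norm `|z| on R[i] is itself R[i]-valued; [modulus] is the same
   norm with values in R (see [modulusE]). *)
Definition modulus (R : realType) (k : scalar_kind) : scalar_field R k -> R :=
  match k return scalar_field R k -> R with
  | RealScalars => fun x => `|x|
  | ComplexScalars => fun z => Normc.normc z
  end.
Arguments modulus {R k}.

Section Scalars.
Context {R : realType} {k : scalar_kind}.
Notation K := (scalar_field R k).

Lemma modulusE (z : K) : to_scalar (modulus z) = `|z|.
Proof. by case: k z. Qed.

Lemma to_scalarD (x y : R) : to_scalar (x + y) = to_scalar x + to_scalar y :> K.
Proof. by case: k => //=; rewrite rmorphD. Qed.

Lemma to_scalarM (x y : R) : to_scalar (x * y) = to_scalar x * to_scalar y :> K.
Proof. by case: k => //=; rewrite rmorphM. Qed.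

Lemma to_scalar0 : to_scalar (0 : R) = 0 :> K.
Proof. by case: k. Qed.

Lemma to_scalar1 : to_scalar (1 : R) = 1 :> K.
Proof. by case: k. Qed.

Lemma ler_to_scalar (x y : R) : (to_scalar x <= to_scalar y :> K) = (x <= y).
Proof. by case: k => //=; rewrite /Order.le/= eqxx. Qed.

Lemma to_scalar_inj : injective (to_scalar : R -> K).
Proof. by move=> x y e; apply/le_anti; rewrite -!ler_to_scalar e lexx. Qed.

Lemma modulus_ge0 (z : K) : 0 <= modulus z.
Proof. by rewrite -ler_to_scalar modulusE to_scalar0. Qed.

Lemma modulus_to_scalar (x : R) : 0 <= x -> modulus (to_scalar x : K) = x.
Proof.
move=> x0; apply: to_scalar_inj; rewrite modulusE ger0_norm//.
by rewrite -to_scalar0 ler_to_scalar.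
Qed.

Lemma modulusD (x y : K) : modulus (x + y) <= modulus x + modulus y.
Proof. by rewrite -ler_to_scalar to_scalarD !modulusE ler_normD. Qed.

Lemma modulusM (x y : K) : modulus (x * y) = modulus x * modulus y.
Proof. by apply: to_scalar_inj; rewrite to_scalarM !modulusE normrM. Qed.

Lemma modulus0 : modulus (0 : K) = 0.
Proof. by apply: to_scalar_inj; rewrite modulusE normr0 to_scalar0. Qed.

Lemma modulus0_eq0 (z : K) : modulus z = 0 -> z = 0.
Proof. by move=> e; apply/normr0_eq0; rewrite -modulusE e to_scalar0. Qed.

Lemma modulus_normr (z : K) : modulus (`|z|) = modulus z.
Proof. by rewrite -modulusE modulus_to_scalar// modulus_ge0. Qed.

End Scalars.

Section EsumScale.
Variables (R : realType) (T : choiceType).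
Local Open Scope ereal_scope.

Lemma esumZ (a : T -> \bar R) (c : R) : (0 <= c)%R -> (forall i, 0 <= a i) ->
  \esum_(i in [set: T]) (c%:E * a i) = c%:E * \esum_(i in [set: T]) a i.
Proof.
move=> c0 a0; rewrite /esum -ereal_supZl//; last first.
  by apply/set0P; exists 0; exists set0; [exact: fsets_set0|rewrite fsbig_set0].
congr ereal_sup; apply/seteqP; split => [x [A fA <-]|x [_ [A fA <-] <-]].
  exists (\sum_(x \in A) a x); first by exists A.
  by rewrite ge0_mule_fsumr.
by exists A => //; rewrite ge0_mule_fsumr.
Qed.

End EsumScale.

(* ||f||_p ^ p *)
Definition lp_sum (R : realType) (k : scalar_kind) (p : R)
    (f : int -> (scalar_field R k)^o) : \bar R :=
  \esum_(n in [set: int]) ((modulus (f n)) `^ p)%:E.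

Definition lp_pred (R : realType) (k : scalar_kind) (p : R) (p1 : 1 <= p) :
    {pred int -> (scalar_field R k)^o} := fun f => (lp_sum p f < +oo)%E.
Arguments lp_pred {R} k {p} p1.

Section Minkowski.
Context {R : realType} {k : scalar_kind} {p : R} (p1 : 1 <= p).
Notation K := (scalar_field R k).
Implicit Types f g : int -> K^o.

Let p0 : 0 < p. Proof. exact: lt_le_trans p1. Qed.

Lemma lp_sum_ge0 f : (0 <= lp_sum p f)%E.
Proof. by apply: esum_ge0 => n _; rewrite lee_fin powR_ge0. Qed.

Lemma powRD_le (x y A B : R) : 0 <= x -> 0 <= y -> 0 < A -> 0 < B ->
  (x + y) `^ p <= (A + B) `^ p *
     (A / (A + B) / A `^ p * x `^ p + B / (A + B) / B `^ p * y `^ p).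
Proof.
move=> x0 y0 A0 B0.
have AB0 : 0 < A + B by exact: addr_gt0.
have t0 : 0 <= A / (A + B) by rewrite divr_ge0 ?ltW.
have t1 : A / (A + B) <= 1 by rewrite ler_pdivrMr// mul1r lerDl ltW.
have powRV (z : R) : 0 <= z -> z^-1 `^ p = (z `^ p)^-1.
  by move=> z0; rewrite -powR_inv1// powRAC powR_inv1// powR_ge0.
have H : (A / (A + B) * (x / A) + (1 - A / (A + B)) * (y / B)) `^ p <=
    A / (A + B) * (x / A) `^ p + (1 - A / (A + B)) * (y / B) `^ p.
  have := @convex_powR R p p1 (Itv01 t0 t1) (x / A) (y / B).
  by rewrite !inE/= !in_itv/= !andbT !divr_ge0 ?(ltW A0) ?(ltW B0)//; apply.
have tc : 1 - A / (A + B) = B / (A + B) by field; rewrite gt_eqF.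
rewrite tc in H.
have -> : x + y = (A + B) * (A / (A + B) * (x / A) + B / (A + B) * (y / B)).
  by field; rewrite ?gt_eqF.
rewrite powRM ?(ltW AB0)//; last first.
  by rewrite addr_ge0// !mulr_ge0// ?invr_ge0 ltW.
apply: ler_wpM2l; rewrite ?powR_ge0//; apply: (le_trans H).
rewrite !powRM ?invr_ge0 ?(ltW A0) ?(ltW B0)// !powRV ?(ltW A0) ?(ltW B0)//.
by rewrite le_eqVlt; apply/orP; left; apply/eqP; ring.
Qed.

Lemma lp_sumD_le f g (A B : R) : 0 < A -> 0 < B ->
  (lp_sum p (f + g)%R <= ((A + B) `^ p)%:E *
   ((A / (A + B) / A `^ p)%:E * lp_sum p f +
    (B / (A + B) / B `^ p)%:E * lp_sum p g))%E.
Proof.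
move=> A0 B0; have AB0 : 0 < A + B by exact: addr_gt0.
have cA : 0 <= A / (A + B) / A `^ p by rewrite !divr_ge0 ?powR_ge0// ltW.
have cB : 0 <= B / (A + B) / B `^ p by rewrite !divr_ge0 ?powR_ge0// ltW.
rewrite /lp_sum -!esumZ//; try by move=> n; rewrite lee_fin powR_ge0.
  rewrite -esumD; try by move=> n _; rewrite mule_ge0// lee_fin ?powR_ge0.
  rewrite -esumZ ?powR_ge0//; last first.
    by move=> n; rewrite adde_ge0// mule_ge0// lee_fin ?powR_ge0.
  apply: le_esum => n _; rewrite -!EFinM. rewrite lee_fin.
  apply: le_trans (powRD_le _ _ A0 B0); rewrite ?modulus_ge0//.
  by rewrite ge0_ler_powR ?nnegrE ?addr_ge0 ?modulus_ge0 ?modulusD ?ltW.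
Qed.

Lemma lp_sumZ (c : K) f : lp_sum p (c *: f) = ((modulus c `^ p)%:E * lp_sum p f)%E.
Proof.
rewrite /lp_sum -esumZ ?powR_ge0//; last by move=> n; rewrite lee_fin powR_ge0.
by apply: eq_esum => n _; rewrite -EFinM -powRM ?modulus_ge0// -modulusM.
Qed.

Lemma lp_sum0 : lp_sum p (0 : int -> K^o) = 0%E.
Proof.
by apply: esum1 => n _; rewrite modulus0 powR0// gt_eqF.
Qed.

Lemma lp_pred_submod_closed : submod_closed (lp_pred k p1).
Proof.
split; first by rewrite /lp_pred unfold_in/= lp_sum0 ltry.
move=> c f g; rewrite !unfold_in/= => ff fg.
apply: le_lt_trans (lp_sumD_le _ _ (@ltr01 R) (@ltr01 R)) _.
have fin (h : int -> K^o) : (lp_sum p h < +oo -> lp_sum p h \is a fin_num)%E.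
  by move=> hoo; rewrite ge0_fin_numE//; exact: lp_sum_ge0.
rewrite lp_sumZ -(fineK (fin _ ff)) -(fineK (fin _ fg)).
by rewrite -!EFinM ltry.
Qed.

End Minkowski.

HB.instance Definition _ (R : realType) (k : scalar_kind) (p : R)
    (p1 : 1 <= p) :=
  GRing.isSubmodClosed.Build (scalar_field R k) (int -> (scalar_field R k)^o)
    (lp_pred k p1) (lp_pred_submod_closed p1).

Record lp (R : realType) (k : scalar_kind) (p : R) (p1 : 1 <= p) := Lp {
  lp_fun :> int -> (scalar_field R k)^o;
  lp_funP : lp_fun \in lp_pred k p1
}.
Arguments lp {R} k {p} p1.

HB.instance Definition _ (R : realType) (k : scalar_kind) (p : R)
  (p1 : 1 <= p) := [isSub for @lp_fun R k p p1].
HB.instance Definition _ (R : realType) (k : scalar_kind) (p : R)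
  (p1 : 1 <= p) := [Choice of lp k p1 by <:].
HB.instance Definition _ (R : realType) (k : scalar_kind) (p : R)
  (p1 : 1 <= p) := [SubChoice_isSubLmodule of lp k p1 by <:].

Definition lp_norm (R : realType) (k : scalar_kind) (p : R) (p1 : 1 <= p)
  (f : lp k p1) : R := fine (lp_sum p f) `^ p^-1.

Section LpNorm.
Context {R : realType} {k : scalar_kind} {p : R} {p1 : 1 <= p}.
Notation K := (scalar_field R k).
Implicit Types f g : lp k p1.

Let p0 : 0 < p. Proof. exact: lt_le_trans p1. Qed.

Lemma lp_norm_ge0 f : 0 <= lp_norm f.
Proof. exact: powR_ge0. Qed.

Lemma lp_sum_fin f : lp_sum p f \is a fin_num.
Proof. by rewrite ge0_fin_numE ?lp_sum_ge0//; exact: (lp_funP f). Qed.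

Lemma lp_normE f : lp_sum p f = (lp_norm f `^ p)%:E.
Proof.
rewrite /lp_norm -powRrM mulVf ?gt_eqF// powRr1 ?fineK ?lp_sum_fin//.
by rewrite fine_ge0// lp_sum_ge0.
Qed.

Lemma lp_norm_le f (c : R) : 0 <= c -> (lp_sum p f <= (c `^ p)%:E)%E ->
  lp_norm f <= c.
Proof.
move=> c0; rewrite lp_normE lee_fin => h.
rewrite leNgt; apply/negP => clt; move: h; rewrite leNgt => /negP; apply.
by apply: gt0_ltr_powR => //; rewrite nnegrE ?lp_norm_ge0.
Qed.

Lemma lp_normD_lt f g (A B : R) : lp_norm f < A -> lp_norm g < B ->
  lp_norm (f + g) <= A + B.
Proof.
move=> fA gB.
have A0 : 0 < A by rewrite (le_lt_trans _ fA) ?lp_norm_ge0.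
have B0 : 0 < B by rewrite (le_lt_trans _ gB) ?lp_norm_ge0.
have AB0 : 0 < A + B by exact: addr_gt0.
apply: lp_norm_le; first exact: ltW.
apply: (le_trans (lp_sumD_le p1 f g A0 B0)).
rewrite !lp_normE -!EFinM lee_fin -[leRHS]mulr1.
apply: ler_wpM2l; first exact: powR_ge0.
have le1 (C D : R) (h : lp k p1) : 0 < C -> 0 < D -> lp_norm h <= C ->
    C / D / C `^ p * lp_norm h `^ p <= C / D.
  move=> C0 D0 hC; rewrite -mulrA -[leRHS]mulr1.
  apply: ler_wpM2l; first by rewrite divr_ge0 ?(ltW C0) ?(ltW D0).
  rewrite mulrC ler_pdivrMr ?powR_gt0// mul1r.
  by apply: ge0_ler_powR => //; rewrite ?nnegrE; [exact: ltW|exact: lp_norm_ge0|exact: ltW].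
apply: (@le_trans _ _ (A / (A + B) + B / (A + B))).
  by apply: lerD; apply: le1 => //; exact: ltW.
by rewrite -mulrDl divff// gt_eqF.
Qed.

Lemma lp_normD f g : lp_norm (f + g) <= lp_norm f + lp_norm g.
Proof.
apply/ler_addgt0Pr => e e0.
apply: (@le_trans _ _ ((lp_norm f + e / 2) + (lp_norm g + e / 2))).
  by apply: lp_normD_lt; rewrite ltrDl divr_gt0.
by rewrite addrACA -splitr.
Qed.

Lemma lp_normZ (c : K) f : lp_norm (c *: f) = modulus c * lp_norm f.
Proof.
rewrite {1}/lp_norm lp_sumZ lp_normE/= -powRM ?modulus_ge0 ?lp_norm_ge0//.
by rewrite -powRrM mulfV ?gt_eqF// powRr1// mulr_ge0 ?modulus_ge0 ?lp_norm_ge0.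
Qed.

Lemma lp_coord_le f n : modulus (f n) <= lp_norm f.
Proof.
rewrite leNgt; apply/negP => h.
have : ((modulus (f n) `^ p)%:E <= lp_sum p f)%E.
  apply: esum_ge; exists [set n]; first by split.
  by rewrite fsbig_set1.
rewrite lp_normE lee_fin leNgt => /negP; apply.
by apply: gt0_ltr_powR => //; rewrite nnegrE ?lp_norm_ge0 ?modulus_ge0.
Qed.

Lemma lp_norm0_eq0 f : lp_norm f = 0 -> f = 0.
Proof.
move=> f0; apply/val_inj/funext => n; apply: modulus0_eq0; apply/le_anti.
by rewrite modulus_ge0 andbT -f0 lp_coord_le.
Qed.

(* a normedModType over the scalars wants a scalar-valued norm *)
Definition lp_normK f : K := to_scalar (lp_norm f).

Lemma lp_normKD f g : lp_normK (f + g) <= lp_normK f + lp_normK g.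
Proof. by rewrite -to_scalarD ler_to_scalar lp_normD. Qed.

Lemma lp_normKZ (c : K) f : lp_normK (c *: f) = `|c| * lp_normK f.
Proof. by rewrite /lp_normK lp_normZ to_scalarM modulusE. Qed.

Lemma lp_normK0_eq0 f : lp_normK f = 0 -> f = 0.
Proof.
by move=> h; apply/lp_norm0_eq0/(@to_scalar_inj R k); rewrite to_scalar0.
Qed.

End LpNorm.

HB.instance Definition _ (R : realType) (k : scalar_kind) (p : R)
    (p1 : 1 <= p) :=
  Lmodule_isNormed.Build (scalar_field R k) (lp k p1) (@lp_normKD R k p p1)
    (@lp_normKZ R k p p1) (@lp_normK0_eq0 R k p p1).

Definition bounded_linear (K : numFieldType) (X : normedModType K)
    (f : X -> X) : Prop :=
  linear f /\ exists M, forall x, `|f x| <= M * `|x|.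

Definition bop_pred (K : numFieldType) (X : normedModType K) :
  {pred X -> X} := fun f => `[< bounded_linear f >].
Arguments bop_pred {K} X.

Lemma bop_pred_submod_closed (K : numFieldType) (X : normedModType K) :
  submod_closed (bop_pred X).
Proof.
split.
  apply/asboolP; split; first by move=> c x y; rewrite scaler0 addr0.
  by exists 0 => x; rewrite mul0r normr0.
move=> c f g /asboolP[lf [M fM]] /asboolP[lg [N gN]]; apply/asboolP; split.
  move=> d x y; rewrite !fctE lf lg !scalerDr !scalerA (mulrC d c).
  by rewrite !addrA; congr (_ + _); rewrite -!addrA; congr (_ + _); rewrite addrC.
exists (`|c| * M + N) => x; rewrite mulrDl.
apply: (le_trans (ler_normD _ _)); apply: lerD => //.
by rewrite normrZ -mulrA; apply: ler_wpM2l.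
Qed.

HB.instance Definition _ (K : numFieldType) (X : normedModType K) :=
  GRing.isSubmodClosed.Build K (X -> X) (bop_pred X) (@bop_pred_submod_closed K X).

Record bounded_op (K : numFieldType) (X : normedModType K) := Bop {
  bop_fun :> X -> X;
  bop_funP : bop_fun \in bop_pred X
}.

HB.instance Definition _ (K : numFieldType) (X : normedModType K) :=
  [isSub for @bop_fun K X].
HB.instance Definition _ (K : numFieldType) (X : normedModType K) :=
  [Choice of bounded_op X by <:].
HB.instance Definition _ (K : numFieldType) (X : normedModType K) :=
  [SubChoice_isSubLmodule of bounded_op X by <:].

Section BopTheory.
Context {K : numFieldType} {X : normedModType K}.
Implicit Types f g S : bounded_op X.

Lemma bop_linear f : linear f.
Proof. by have /asboolP[] := bop_funP f. Qed.

HB.instance Definition _ f :=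
  GRing.isLinear.Build K X X *:%R (bop_fun f) (bop_linear f).

Lemma bop_bounded f : exists2 M, 0 < M & forall x, `|f x| <= M * `|x|.
Proof.
have /asboolP[_ [M fM]] := bop_funP f.
have [[x x0]|nx] := pselect (exists x : X, x != 0).
  have M0 : 0 <= M.
    by rewrite -(pmulr_lge0 _ (_ : 0 < `|x|)) ?normr_gt0// (le_trans _ (fM x)).
  by exists (M + 1) => [|y]; [rewrite ltr_wpDl|rewrite mulrDl ler_wpDr// mul1r].
exists 1 => // x; suff -> : x = 0 by rewrite raddf0 normr0 mulr0.
by apply: contrapT => /eqP x0; apply: nx; exists x.
Qed.

Lemma bop_continuous f : continuous f.
Proof.
have [M M0 fM] := bop_bounded f.
apply: bounded_linear_continuous; apply/ex_bound; exists M.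
apply/nbhs_norm0P; exists 1 => //= x /= x1.
by rewrite (le_trans (fM x))// ler_piMr ?ltW.
Qed.

Lemma bop_comp_subproof f g : f \o g \in bop_pred X.
Proof.
apply/asboolP; split; first by move=> c x y; rewrite /= !linearP.
have [M M0 fM] := bop_bounded f; have [N N0 gN] := bop_bounded g.
exists (M * N) => x /=; apply: (le_trans (fM _)).
by rewrite -mulrA; apply: ler_wpM2l; first exact: ltW.
Qed.

Definition bop_comp f g : bounded_op X := Bop (bop_comp_subproof f g).

Definition C_map (A B : bounded_op X) (S : bounded_op X) : bounded_op X :=
  bop_comp A (bop_comp S B).

Lemma C_map_linear (A B : bounded_op X) : linear (C_map A B).
Proof. by move=> c S T; apply/val_inj/funext => x /=; rewrite !linearP. Qed.

End BopTheory.

Definition cop_pred (K : numFieldType) (X : normedModType K) :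
  {pred bounded_op X} := fun S => `[< precompact (S @` [set x : X | `|x| <= 1]) >].
Arguments cop_pred {K} X.

Section CopClosed.
Context {K : numFieldType} {X : normedModType K}.
Implicit Types S T : bounded_op X.

Lemma precompact_image (f : X -> X) (A : set X) :
  continuous f -> precompact A -> precompact (f @` A).
Proof.
rewrite (precompactE A) => cf cA.
apply: (@precompact_subset _ _ (f @` closure A)).
  by apply: image_subset; exact: subset_closure.
apply: compact_precompact; first exact: norm_hausdorff.
by apply: continuous_compact => //; exact: continuous_subspaceT.
Qed.

Lemma precompactD (A B : set X) : precompact A -> precompact B ->
  precompact [set x.1 + x.2 | x in A `*` B].
Proof.
rewrite (precompactE A) (precompactE B) => cA cB.
apply: (@precompact_subset _ _ ((fun x : X * X => x.1 + x.2) @` (closure A `*` closure B))).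
  by apply: image_subset => -[x y] [/= Ax By]; split; exact: subset_closure.
apply: compact_precompact; first exact: norm_hausdorff.
apply: continuous_compact; last exact: compact_setX.
by apply: continuous_subspaceT; exact: add_continuous.
Qed.

Lemma cop_pred_submod_closed : submod_closed (cop_pred X).
Proof.
split.
  apply/asboolP; apply: (@precompact_subset _ _ [set 0]).
    by move=> _ [x _ <-].
  by apply: compact_precompact; [exact: norm_hausdorff|exact: compact_set1].
move=> c S T /asboolP cS /asboolP cT; apply/asboolP.
have cS' := precompact_image (@scaler_continuous _ _ c) cS.
apply: (precompact_subset _ (precompactD cS' cT)) => _ [x x1 <-].
by exists (c *: S x, T x) => //; split; [exists (S x) => //; exists x|exists x].
Qed.

End CopClosed.

HB.instance Definition _ (K : numFieldType) (X : normedModType K) :=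
  GRing.isSubmodClosed.Build K (bounded_op X) (cop_pred X) (@cop_pred_submod_closed K X).

Record compact_op (K : numFieldType) (X : normedModType K) := Cop {
  cop_bop :> bounded_op X;
  cop_bopP : cop_bop \in cop_pred X
}.

HB.instance Definition _ (K : numFieldType) (X : normedModType K) :=
  [isSub for @cop_bop K X].
HB.instance Definition _ (K : numFieldType) (X : normedModType K) :=
  [Choice of compact_op X by <:].
HB.instance Definition _ (K : numFieldType) (X : normedModType K) :=
  [SubChoice_isSubLmodule of compact_op X by <:].

Section CmapCompact.
Context {K : numFieldType} {X : normedModType K}.

Lemma C_map_compact (A B : bounded_op X) (S : compact_op X) : C_map A B S \in cop_pred X.
Proof.
apply/asboolP; have /asboolP cS := cop_bopP S.
have [M M0 BM] := bop_bounded B.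
have cMS := precompact_image (@scaler_continuous _ _ M) cS.
apply: (precompact_subset _ (precompact_image (@bop_continuous _ _ A) cMS)).
move=> _ [x /= x1 <-]; exists (S (B x)) => //; exists (S (M^-1 *: B x)).
  exists (M^-1 *: B x) => //=; rewrite normrZ gtr0_norm ?invr_gt0//.
  rewrite ler_pdivrMl// mulr1 (le_trans (BM x))//.
  by rewrite ler_piMr// ltW.
by rewrite linearZ/= scalerA divff ?gt_eqF// scale1r.
Qed.

Definition C_cop (A B : bounded_op X) (S : compact_op X) : compact_op X :=
  Cop (C_map_compact A B S).

End CmapCompact.
Definition opnorm (R : realType) (k : scalar_kind)
    (X : normedModType (scalar_field R k)) (S : bounded_op X) : R :=
  sup [set modulus `|S x| | x in [set x : X | `|x| <= 1]].

Section OpNorm.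
Context {R : realType} {k : scalar_kind} {X : normedModType (scalar_field R k)}.
Notation K := (scalar_field R k).
Implicit Types S T : bounded_op X.

Lemma ler_modulus (x y : K) : 0 <= x -> x <= y -> modulus x <= modulus y.
Proof.
move=> x0 xy; rewrite -(@ler_to_scalar R k) !modulusE !ger0_norm//.
exact: le_trans xy.
Qed.

Lemma opnorm_has_sup S :
  has_sup [set modulus `|S x| | x in [set x : X | `|x| <= 1]].
Proof.
split; first by exists (modulus `|S 0|), 0 => //=; rewrite normr0.
have [M M0 SM] := bop_bounded S; exists (modulus M) => _ [x /= x1 <-].
by rewrite ler_modulus// (le_trans (SM x))// ler_piMr// ltW.
Qed.

Lemma opnorm_ub S x : `|x| <= 1 -> modulus `|S x| <= opnorm S.
Proof. by move=> x1; apply: sup_upper_bound (opnorm_has_sup S) _ _; exists x. Qed.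

Lemma opnorm_le S (c : R) :
  (forall x, `|x| <= 1 -> modulus `|S x| <= c) -> opnorm S <= c.
Proof.
move=> Sc; apply: ge_sup; first by have [] := opnorm_has_sup S.
by move=> _ [x /= x1 <-]; exact: Sc.
Qed.

Lemma opnorm_ge0 S : 0 <= opnorm S.
Proof.
by apply: le_trans (@opnorm_ub S 0 _); rewrite ?normr0// modulus_ge0.
Qed.

Lemma opnormP S x : `|S x| <= to_scalar (opnorm S) * `|x|.
Proof.
have [->|x0] := eqVneq x 0; first by rewrite raddf0 !normr0 mulr0.
have nx0 : 0 < `|x| by rewrite normr_gt0.
rewrite -ler_pdivrMr// mulrC.
have -> : `|x|^-1 * `|S x| = `|S (`|x|^-1 *: x)|.
  by rewrite linearZ/= normrZ gtr0_norm// invr_gt0.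
rewrite -normr_id -modulusE ler_to_scalar opnorm_ub//.
by rewrite normrZ gtr0_norm ?invr_gt0// mulVf ?gt_eqF.
Qed.

Lemma opnormD S T : opnorm (S + T) <= opnorm S + opnorm T.
Proof.
apply: opnorm_le => x x1; rewrite -(@ler_to_scalar R k) to_scalarD modulusE.
rewrite normr_id (le_trans (ler_normD _ _))//.
by apply: lerD; rewrite -normr_id -modulusE ler_to_scalar opnorm_ub.
Qed.

Lemma opnormZ_le (c : K) S : opnorm (c *: S) <= modulus c * opnorm S.
Proof.
apply: opnorm_le => x x1; rewrite /= -(modulus_normr c) normrZ modulusM.
by apply: ler_wpM2l; rewrite ?modulus_ge0// opnorm_ub.
Qed.

Lemma opnormZ (c : K) S : opnorm (c *: S) = modulus c * opnorm S.
Proof.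
apply/le_anti; rewrite opnormZ_le/=.
have [->|c0] := eqVneq c 0; first by rewrite modulus0 mul0r opnorm_ge0.
have mc : modulus c * modulus c^-1 = 1.
  by rewrite -modulusM divff//; apply: (@to_scalar_inj R k);
     rewrite modulusE normr1 to_scalar1.
rewrite -[leRHS]mul1r -mc -mulrA ler_wpM2l ?modulus_ge0//.
by rewrite -{1}(scale1r S) -(mulVf c0) -scalerA opnormZ_le.
Qed.

Lemma opnorm0_eq0 S : opnorm S = 0 -> S = 0.
Proof.
move=> S0; apply/val_inj/funext => x; apply/normr0_eq0/le_anti.
by rewrite normr_ge0 andbT (le_trans (opnormP S x))// S0 to_scalar0 mul0r.
Qed.

Definition cop_norm (S : compact_op X) : K := to_scalar (opnorm S).

Lemma cop_normD (S T : compact_op X) : cop_norm (S + T) <= cop_norm S + cop_norm T.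
Proof. by rewrite -to_scalarD ler_to_scalar opnormD. Qed.

Lemma cop_normZ (c : K) (S : compact_op X) : cop_norm (c *: S) = `|c| * cop_norm S.
Proof. by rewrite /cop_norm opnormZ to_scalarM modulusE. Qed.

Lemma cop_norm0_eq0 (S : compact_op X) : cop_norm S = 0 -> S = 0.
Proof.
move=> h; apply/val_inj/opnorm0_eq0/(@to_scalar_inj R k).
by rewrite to_scalar0.
Qed.

End OpNorm.

HB.instance Definition _ (R : realType) (k : scalar_kind)
    (X : normedModType (scalar_field R k)) :=
  Lmodule_isNormed.Build (scalar_field R k) (compact_op X) (@cop_normD R k X)
    (@cop_normZ R k X) (@cop_norm0_eq0 R k X).

(* [sot X] and [cot X] are copies of L(X) = [bounded_op X] carrying the strong
   operator topology and the topology of uniform convergence on compact sets. *)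
Definition sot (K : numFieldType) (X : normedModType K) : Type := bounded_op X.

HB.instance Definition _ (K : numFieldType) (X : normedModType K) :=
  GRing.Lmodule.on (sot X).
HB.instance Definition _ (K : numFieldType) (X : normedModType K) :=
  Topological.copy (sot X)
    (initial_topology (fun S : bounded_op X => (S : X -> X) : {ptws X -> X})).

Definition cot (K : numFieldType) (X : normedModType K) : Type := bounded_op X.

HB.instance Definition _ (K : numFieldType) (X : normedModType K) :=
  GRing.Lmodule.on (cot X).
HB.instance Definition _ (K : numFieldType) (X : normedModType K) :=
  Topological.copy (cot X)
    (initial_topology (fun S : bounded_op X => (S : X -> X) : {family compact, X -> X})).

Section SotTvs.
Context {K : numFieldType} {X : normedModType K}.

Lemma sot_eval (x : X) : continuous (fun S : sot X => (S : bounded_op X) x).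
Proof.
move=> S; apply: (@continuous_comp (sot X) {ptws X -> X} X
  (fun S => (S : bounded_op X) : X -> X) (fun f => f x)).
  exact: initial_continuous.
exact: (@proj_continuous X (fun=> X) x).
Qed.

Lemma sot_continuous (T : topologicalType) (h : T -> sot X) :
  (forall x, continuous (fun t => (h t : bounded_op X) x)) -> continuous h.
Proof.
move=> H; apply: (@continuous_comp_initial (bounded_op X) T {ptws X -> X}) => t.
apply/cvg_sup => x U [V [[W oW <-] WV] VU]; apply: filterS VU _.
by apply: (H x t); exact: open_nbhs_nbhs.
Qed.

Lemma sot_add_continuous : continuous (fun z : sot X * sot X => z.1 + z.2).
Proof.
apply: sot_continuous => x z.
apply: (@cvgD _ _ _ _ _ (fun z : sot X * sot X => (z.1 : bounded_op X) x)
                         (fun z : sot X * sot X => (z.2 : bounded_op X) x)).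
  by apply: (@continuous_comp (sot X * sot X)%type (sot X) X fst (fun S => (S : bounded_op X) x));
    [exact: cvg_fst|exact: sot_eval].
by apply: (@continuous_comp (sot X * sot X)%type (sot X) X snd (fun S => (S : bounded_op X) x));
    [exact: cvg_snd|exact: sot_eval].
Qed.

Lemma sot_scale_continuous : continuous (fun z : K^o * sot X => z.1 *: z.2).
Proof.
apply: sot_continuous => x z.
apply: (@cvgZ _ _ _ _ _ (fun z : K^o * sot X => z.1)
                        (fun z : K^o * sot X => (z.2 : bounded_op X) x)).
  exact: cvg_fst.
by apply: (@continuous_comp (K^o * sot X)%type (sot X) X snd (fun S => (S : bounded_op X) x));
    [exact: cvg_snd|exact: sot_eval].
Qed.

End SotTvs.

HB.instance Definition _ (K : numFieldType) (X : normedModType K) :=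
  PreTopologicalNmodule_isTopologicalNmodule.Build (sot X)
    (@sot_add_continuous K X).
HB.instance Definition _ (K : numFieldType) (X : normedModType K) :=
  TopologicalNmodule_isTopologicalLmodule.Build K (sot X)
    (@sot_scale_continuous K X).

Section CotTvs.
Context {K : numFieldType} {X : normedModType K}.

Lemma cot_nbhs (S : cot X) (A : set X) (e : K) : compact A -> 0 < e ->
  nbhs S [set T : cot X | forall y, A y ->
    `|(S : bounded_op X) y - (T : bounded_op X) y| < e].
Proof.
move=> cA e0.
have : nbhs ((S : bounded_op X) : {family compact, X -> X})
    [set f : X -> X | forall y, A y -> `|(S : bounded_op X) y - f y| < e].
  have /fam_cvgP/(_ A cA) : nbhs ((S : bounded_op X) : {family compact, X -> X})
    --> ((S : bounded_op X) : {family compact, X -> X}) by exact: cvg_id.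
  apply; apply/uniform_nbhs; exists [set xy | ball xy.1 e xy.2]; split.
    by apply: entourage_ball (PosNum e0).
  by move=> f; rewrite -ball_normE.
exact: (@initial_continuous (bounded_op X) {family compact, X -> X} _ S).
Qed.

Lemma cot_continuous (T : topologicalType) (h : T -> cot X) :
  (forall t (A : set X) (e : K), compact A -> 0 < e -> \forall u \near t,
    forall y, A y -> `|(h t : bounded_op X) y - (h u : bounded_op X) y| < e) -> continuous h.
Proof.
move=> H; apply: (@continuous_comp_initial (bounded_op X) T {family compact, X -> X}) => t.
apply/fam_cvgP => A cA U /uniform_nbhs[E [entE EU]].
move: entE; rewrite -entourage_ballE => -[e /= e0 eE].
apply: filterS (H t A e cA e0) => u hu; apply: EU => y Ay; apply: eE.
by rewrite /= -ball_normE; exact: hu.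
Qed.

Lemma cot_add_continuous : continuous (fun z : cot X * cot X => z.1 + z.2).
Proof.
apply: cot_continuous => -[S T] A e cA e0.
have e20 : 0 < e / 2 by rewrite divr_gt0.
exists ([set S' : cot X | forall y, A y -> `|(S : bounded_op X) y - (S' : bounded_op X) y| < e / 2],
        [set S' : cot X | forall y, A y -> `|(T : bounded_op X) y - (S' : bounded_op X) y| < e / 2]).
  by split; exact: cot_nbhs.
move=> [S' T'] [/= hS hT] y Ay; rewrite opprD addrACA (splitr e).
by rewrite (le_lt_trans (ler_normD _ _))// ltrD ?hS ?hT.
Qed.

Lemma cot_scale_continuous : continuous (fun z : K^o * cot X => z.1 *: z.2).
Proof.
apply: cot_continuous => -[c S] A e cA e0.
have [M M0 AM] : exists2 M : K, 0 < M & forall y, A y -> `|(S : bounded_op X) y| < M.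
  have /compact_near_coveringP/(_ K (pinfty_nbhs K)
      (fun M y => `|(S : bounded_op X) y| < M)) := cA.
  case=> [x Ax|M [Mr hM]].
    exists ([set y | `|(S : bounded_op X) x - (S : bounded_op X) y| < 1],
            [set M | `|(S : bounded_op X) x| + 1 < M]).
      split; last by apply: nbhs_pinfty_gt; rewrite realD ?normr_real ?real1.
      have /cvgrPdist_lt/(_ 1 ltr01) := @bop_continuous _ _ (S : bounded_op X) x.
      exact.
    move=> [y M] [/= xy xM]; apply: lt_trans xM.
    rewrite -[(S : bounded_op X) y](subrK ((S : bounded_op X) x)) addrC.
    by rewrite (le_lt_trans (ler_normD _ _))// ltrD2l distrC.
  exists (`|M| + 1) => [|y]; first by rewrite ltr_wpDl.
  apply: hM; rewrite (@le_lt_trans _ _ `|M|) ?ltrDl//.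
  exact: real_ler_norm.
have c0 : 0 < `|c| + 1 by rewrite ltr_wpDl.
have eM0 : 0 < e / 2 / M by rewrite !divr_gt0.
have ec0 : 0 < e / 2 / (`|c| + 1) by rewrite !divr_gt0.
exists ([set d : K^o | `|c - d| < 1] `&` [set d : K^o | `|c - d| < e / 2 / M],
        [set S' : cot X | forall y, A y ->
           `|(S : bounded_op X) y - (S' : bounded_op X) y| < e / 2 / (`|c| + 1)]).
  split; last exact: cot_nbhs.
  by apply: filterI; apply/nbhs_normP; [exists 1 => /=|exists (e / 2 / M) => /=].
move=> [d S'] [/= [cd1 cdM] hS] y Ay.
have -> : c *: (S : bounded_op X) y - d *: (S' : bounded_op X) y =
    (c - d) *: (S : bounded_op X) y + d *: ((S : bounded_op X) y - (S' : bounded_op X) y).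
  by rewrite scalerBl scalerBr addrA subrK.
have dc : `|d| <= `|c| + 1.
  rewrite -[d](subrK c) addrC (le_trans (ler_normD _ _))// lerD2l distrC.
  exact: ltW.
rewrite (le_lt_trans (ler_normD _ _))// (splitr e) !normrZ ltr_leD//.
  rewrite (@le_lt_trans _ _ (`|c - d| * M))//; last by rewrite -ltr_pdivlMr.
  by apply: ler_wpM2l => //; rewrite ltW// AM.
rewrite (@le_trans _ _ ((`|c| + 1) * (e / 2 / (`|c| + 1))))//.
  by apply: ler_pM => //; rewrite ltW// hS.
by rewrite mulrC divfK// gt_eqF.
Qed.

End CotTvs.

HB.instance Definition _ (K : numFieldType) (X : normedModType K) :=
  PreTopologicalNmodule_isTopologicalNmodule.Build (cot X)
    (@cot_add_continuous K X).
HB.instance Definition _ (K : numFieldType) (X : normedModType K) :=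
  TopologicalNmodule_isTopologicalLmodule.Build K (cot X)
    (@cot_scale_continuous K X).

Definition bounded_seq (R : realType) (k : scalar_kind)
    (a : int -> scalar_field R k) : Prop :=
  exists M : R, forall n, modulus (a n) <= M.

Section WeightedShift.
Context {R : realType} {k : scalar_kind} {p : R} {p1 : 1 <= p}.
Notation K := (scalar_field R k).
Implicit Types (a : int -> K) (d : int).

Let p0 : 0 < p. Proof. exact: lt_le_trans p1. Qed.

Lemma lp_sum_translate d (f : int -> K^o) :
  lp_sum p (fun n => f (n + d)) = lp_sum p f.
Proof.
rewrite /lp_sum; symmetry.
apply: (@reindex_esum R int int setT setT (fun n : int => n + d)).
split; first by [].
  by move=> x y _ _ /addIr.
by move=> x _; exists (x - d) => //; rewrite subrK.
Qed.

Lemma lp_sum_wshift d a (M : R) (f : int -> K^o) :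
  (forall n, modulus (a n) <= M) ->
  (lp_sum p (fun n => a (n + d) * f (n + d))%R <= (M `^ p)%:E * lp_sum p f)%E.
Proof.
move=> aM; rewrite (lp_sum_translate d (fun n => a n * f n)).
have M0 : 0 <= M by apply: le_trans (aM 0); exact: modulus_ge0.
rewrite /lp_sum -esumZ ?powR_ge0//; last by move=> n; rewrite lee_fin powR_ge0.
apply: le_esum => n _; rewrite -EFinM lee_fin modulusM.
rewrite powRM ?modulus_ge0//; apply: ler_wpM2r; first exact: powR_ge0.
by apply: ge0_ler_powR; rewrite ?nnegrE ?modulus_ge0//; exact: ltW.
Qed.

Lemma wshift_lp d a (ha : bounded_seq a) (f : lp k p1) :
  (fun n => a (n + d) * f (n + d)) \in lp_pred k p1.
Proof.
have [M aM] := ha; rewrite unfold_in.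
apply: le_lt_trans (lp_sum_wshift d f aM) _.
by rewrite lp_normE -EFinM ltry.
Qed.

Definition wshift_fun d a (ha : bounded_seq a) (f : lp k p1) : lp k p1 :=
  Lp (wshift_lp d ha f).

Lemma wshift_bop d a (ha : bounded_seq a) : wshift_fun d ha \in bop_pred (lp k p1).
Proof.
apply/asboolP; split.
  move=> c f g; apply/val_inj/funext => n /=; rewrite !fctE /=.
  by rewrite mulrDr /GRing.scale/= !mulrA (mulrC c).
have [M aM] := ha; exists (to_scalar M) => f.
have M0 : 0 <= M by apply: le_trans (aM 0); exact: modulus_ge0.
suff : lp_norm (wshift_fun d ha f) <= M * lp_norm f.
  by rewrite -(@ler_to_scalar R k) to_scalarM.
apply: lp_norm_le; first by rewrite mulr_ge0// lp_norm_ge0.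
apply: le_trans (lp_sum_wshift d f aM) _.
by rewrite lp_normE -EFinM powRM// lp_norm_ge0.
Qed.

(* e_n |-> a_n e_{n-d}, see [wshift_basis] *)
Definition wshift d a (ha : bounded_seq a) : bounded_op (lp k p1) :=
  Bop (wshift_bop d ha).

Lemma lp_basis_lp (n : int) : (fun m : int => ((m == n)%:R : K^o)) \in lp_pred k p1.
Proof.
rewrite unfold_in /lp_sum (esumID [set n]); last first.
  by move=> m _; rewrite lee_fin powR_ge0.
rewrite !setTI esum_set1 ?lee_fin ?powR_ge0// [X in (_ + X)%E]esum1.
  by rewrite adde0 ltry.
by move=> m /eqP/negbTE ->; rewrite modulus0 powR0// gt_eqF.
Qed.

Definition lp_basis (n : int) : lp k p1 := Lp (lp_basis_lp n).

Lemma wshift_basis d a (ha : bounded_seq a) (n : int) :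
  wshift d ha (lp_basis n) = a n *: lp_basis (n - d).
Proof.
apply/val_inj/funext => m /=; rewrite fctE /GRing.scale/=.
rewrite -[m == _](inj_eq (@addIr _ d)) subrK.
by have [->|] := eqVneq (m + d) n; rewrite ?mulr0.
Qed.

End WeightedShift.

Definition backward_shift (R : realType) (k : scalar_kind) (p : R)
    (p1 : 1 <= p) (a : int -> scalar_field R k) (ha : bounded_seq a) :
    bounded_op (lp k p1) :=
  wshift 1 ha.

Definition forward_shift (R : realType) (k : scalar_kind) (p : R)
    (p1 : 1 <= p) (b : int -> scalar_field R k) (hb : bounded_seq b) :
    bounded_op (lp k p1) :=
  wshift (- 1) hb.

Lemma backward_shift_basis (R : realType) (k : scalar_kind) (p : R)
    (p1 : 1 <= p) (a : int -> scalar_field R k) (ha : bounded_seq a) (n : int) :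
  backward_shift p1 ha (lp_basis n) = a n *: lp_basis (n - 1).
Proof. exact: wshift_basis. Qed.

Lemma forward_shift_basis (R : realType) (k : scalar_kind) (p : R)
    (p1 : 1 <= p) (b : int -> scalar_field R k) (hb : bounded_seq b) (n : int) :
  forward_shift p1 hb (lp_basis n) = b n *: lp_basis (n + 1).
Proof. by rewrite /forward_shift wshift_basis opprK. Qed.

Definition q_frequently_hypercyclic (R : realType) (k : scalar_kind) (q : nat)
    (E : topologicalLmodType (scalar_field R k)) (A : E -> E) : Prop :=
  [/\ linear A, continuous A &
   exists x : E, forall V : set E, open V -> V !=set0 ->
    (0 < limn_einf (fun N : nat =>
      (#|[pred n : 'I_(N ^ q).+1 | (0 < n)%N && `[< V (iter n A x) >]]|%:R
        / N%:R : R)%:E))%E].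

(* a_1 a_2 ... a_u; only meaningful for 1 <= u *)
Definition prod_up (R : realType) (k : scalar_kind) (a : int -> scalar_field R k)
    (u : int) : scalar_field R k :=
  \prod_(1 <= m < `|u|%N.+1) a m%:Z.

(* a_i a_(i-1) ... a_(i-l+1) *)
Definition prod_down (R : realType) (k : scalar_kind) (a : int -> scalar_field R k)
    (i : int) (l : nat) : scalar_field R k :=
  \prod_(0 <= m < l) a (i - m%:Z).

(* Main.v *)
Require Import Defs.
From HB Require Import structures.
From mathcomp Require Import all_boot all_order all_algebra.
From mathcomp Require Import all_classical all_reals all_analysis.
From mathcomp.real_closed Require Import complex.
From mathcomp Require Import ring lra zify.

(** Let [C] be the map [S |-> T_a S S_b].  Iterating [C] slides matrices along
their diagonals: the entry of [C^m S] at [(i, j)] is the entry of [S] at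
[(i + m, j + m)] times [weight_prod a b i j m].  So a finite matrix [F], moved
down the diagonal by [m] and divided entrywise by these weights, is sent back to
[F] by [C^m].  The two limits in the hypotheses say that the copy of [F] prepared
for the time [n^q] has small entries when it is seen at another time [r^q] with
[|n - r|] large, uniformly in [r]; the first limit serves [r < n], the second
one [n < r].

A good orbit is obtained from a single block-diagonal operator [S].  Choose a
sequence of finite matrices [F_l] which is dense among all finite matrices
([dense_matrices]), and disjoint sets [A_l] of positive lower density whose
elements are as far apart as one likes, the distance being prescribed by [l]
([separated_set]).  For every [n] in [A_l], put the copy of [F_l] prepared for
the time [n^q] on the diagonal of [S], around the index [n^q].  The blocks do not
meet, and on every [l^p] a block-diagonal operator is controlled by its largest
block ([lp_norm_block]).  This is why it suffices that the weighted entries tend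
to zero, where a general criterion would ask for convergent series.
If [r] is in [A_l], the block of [C^(r^q) S] around the origin is [F_l] and all
its other blocks are small, so that [C^(r^q) S] is within [1/(l + 1)] of [F_l] in
operator norm ([orbit_op_hits]).  Since [A_l] has positive lower density, the
orbit of [S] visits every norm neighbourhood of every finite matrix as often as
required ([hitting_operator]), for each [p >= 1].

The operator [S] is compact: its restriction to the unit ball is continuous for
the topology of coordinatewise convergence, and the ball is compact for this
topology ([compact_of_tails]).  The three spaces are then treated at once
([q_frequently_hypercyclic_transfer]): the compact operators map into each of
them continuously and compatibly with [C], and the finite matrices are dense in
each.  Density holds for the strong operator topology and for uniform convergence
on compact sets because the truncations [P_n T P_n] converge to [T] uniformly on
compact sets ([compression_cvg_compact]).  For compact [T] and the operator norm
one needs moreover that [T (1 - P_n)] tends to zero in norm; this is where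
[p > 1] enters, through the fact that a bounded functional on [l^p] has small
tails ([functional_tails]). *)

Set Implicit Arguments.
Unset Strict Implicit.
Unset Printing Implicit Defensive.
Import Order.TTheory GRing.Theory Num.Theory numFieldNormedType.Exports.
Local Open Scope classical_set_scope.
Local Open Scope ring_scope.

(** * Separated sets of positive lower density *)

Section SeparatedSets.
Local Open Scope nat_scope.
Variable gap : nat -> nat.
Hypothesis gap_gt0 : forall l, 0 < gap l.

(** The set of index [l] is built from the integers of 2-adic valuation
[level l]: this makes the sets disjoint, and the growth of [level] outweighs the
gaps, as [gap_le_level] shows. *)
Definition level (l : nat) : nat := l + \sum_(i < l.+1) gap i.

(** The room required around the integer [t].  The gap of [l] is charged to all
multiples of [2 ^ level l], among them the integers of valuation [level l]; a positive
multiple is larger than [l], so that summing over [l < t] loses nothing. *)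
Definition spacing (t : nat) : nat :=
  \sum_(l < t) if 2 ^ level l %| t then gap l else 0.

(** Pulling the integers apart: each [t] receives the room [spacing t] on both
sides. *)
Definition stretch (m : nat) : nat :=
  \sum_(0 <= t < m) spacing t + \sum_(0 <= t < m.+1) spacing t.

Definition separated_set (l : nat) : pred nat :=
  fun n => `[< exists t, n = stretch (2 ^ level l * t.*2.+1) >].

Lemma level_inj : injective level.
Proof.
have lev : {homo level : k l / k < l}.
  apply: homo_ltn => [l k m|l]; first exact: ltn_trans.
  by rewrite /level (big_ord_recr l.+1)/= addSn ltnS leq_add2l leq_addr.
move=> k l; case: (ltngtP k l) => [/lev|/lev|//] + e; by rewrite e ltnn.
Qed.

Lemma gap_le_level l : 2 ^ l * gap l <= 2 ^ level l.
Proof.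
rewrite /level expnD leq_pmul2l ?expn_gt0// (leq_trans (ltnW (ltn_expl (gap l) (ltnSn 1))))//.
by rewrite leq_exp2l// big_ord_recr leq_addl.
Qed.

Lemma spacing_ge l t : 0 < t -> 2 ^ level l %| t -> gap l <= spacing t.
Proof.
move=> t0 lt; have lt' : l < t.
  apply: leq_trans (dvdn_leq t0 lt).
  by rewrite (leq_trans (ltn_expl l (ltnSn 1)))// leq_exp2l// leq_addr.
by rewrite /spacing (bigD1 (Ordinal lt'))//= lt leq_addr.
Qed.

Lemma stretch_sep m m' : m < m' -> stretch m + (spacing m + spacing m') <= stretch m'.
Proof.
move=> mm'; rewrite /stretch.
rewrite (@big_cat_nat _ _ _ m.+1 0 m')//= (@big_cat_nat _ _ _ m' 0 m'.+1)//=.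
rewrite big_nat_recr//= big_nat1.
have : \sum_(0 <= t < m.+1) spacing t <= \sum_(0 <= t < m') spacing t.
  by rewrite (@big_cat_nat _ _ _ m.+1 0 m')//= leq_addr.
by rewrite big_nat_recr//=; lia.
Qed.

Lemma sum_halves m B : \sum_(l < B) m %/ 2 ^ l + (m %/ 2 ^ B).*2 <= m.*2.
Proof.
elim: B => [|B IH]; first by rewrite big_ord0 divn1.
apply: leq_trans IH; rewrite big_ord_recr/= -addnA leq_add2l expnSr divnMA; lia.
Qed.

Lemma count_multiples d m : 0 < d ->
  \sum_(0 <= t < m.+1) (d %| t) = (m %/ d).+1.
Proof.
move=> d0; elim: m => [|m IH]; first by rewrite big_nat1 dvdn0 div0n.
rewrite big_nat_recr//= IH; have := divnS m d0; lia.
Qed.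

(** Up to [m] there are [m %/ 2 ^ level l] multiples of [2 ^ level l], which
contribute at most [m %/ 2 ^ l] to the total spacing; the sum over [l] is at most
[2 * m].  The linear bound is what preserves positive density. *)
Lemma stretch_le m : stretch m <= 4 * m.
Proof.
have sp : \sum_(0 <= t < m.+1) spacing t <= m.*2.
  have {1}-> : \sum_(0 <= t < m.+1) spacing t =
      \sum_(1 <= t < m.+1) \sum_(l < m) if 2 ^ level l %| t then gap l else 0.
    rewrite big_ltn// {1}/spacing big_ord0 add0n; apply: eq_big_nat => t /andP[t0 tm].
    rewrite /spacing -(big_mkord xpredT (fun l => if 2 ^ level l %| t then gap l else 0)).
    rewrite -(big_mkord xpredT (fun l => if 2 ^ level l %| t then gap l else 0)).
    rewrite [RHS](@big_cat_nat _ _ _ t)//= [X in _ = _ + X]big1_seq ?addn0// => l.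
    rewrite mem_index_iota => /andP[_ /andP[tl _]]; case: ifP => // /(dvdn_leq t0) h.
    have := leq_trans h tl; rewrite leqNgt (leq_trans (ltn_expl l (ltnSn 1)))//.
    by rewrite leq_exp2l// leq_addr.
  rewrite exchange_big/=; apply: leq_trans (leq_trans (leq_addr _ _) (sum_halves m m)).
  apply: leq_sum => l _; rewrite leq_divRL ?expn_gt0//.
  have -> : \sum_(1 <= t < m.+1) (if 2 ^ level l %| t then gap l else 0) = gap l * (m %/ 2 ^ level l).
    have := count_multiples m (expn_gt0 2 (level l) : 0 < _).
    rewrite big_ltn// dvdn0 add1n => -[<-]; rewrite big_distrr/=.
    by apply: eq_bigr => t _; case: ifP; rewrite ?muln1 ?muln0.
  rewrite mulnAC (leq_trans _ (leq_trunc_div m (2 ^ level l)))// mulnC leq_mul//.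
  by rewrite mulnC gap_le_level.
rewrite /stretch (_ : 4 * m = m.*2 + m.*2); last by rewrite -!mul2n; lia.
by apply: leq_add => //; apply: leq_trans sp; rewrite [leqRHS]big_nat_recr//= leq_addr.
Qed.

Lemma separated_set_ge l n : separated_set l n -> gap l <= n.
Proof.
move=> /asboolP[t ->]; have m0 : 0 < 2 ^ level l * t.*2.+1 by rewrite muln_gt0 expn_gt0.
apply: leq_trans (spacing_ge m0 (dvdn_mulr _ (dvdnn _))) _.
by rewrite /stretch [X in _ + X]big_nat_recr//= addnA leq_addl.
Qed.

Lemma separated_set_sep l k n r : separated_set l n -> separated_set k r ->
  n < r -> n + (gap l + gap k) <= r.
Proof.
move=> /asboolP[t ->] /asboolP[t' ->].
have m0 i s : 0 < 2 ^ level i * s.*2.+1 by rewrite muln_gt0 expn_gt0.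
have h i s := spacing_ge (m0 i s) (dvdn_mulr s.*2.+1 (dvdnn (2 ^ level i))).
case: (ltngtP (2 ^ level l * t.*2.+1) (2 ^ level k * t'.*2.+1)) => [lt|lt|->].
- by have := stretch_sep lt; have := h l t; have := h k t'; lia.
- by have := stretch_sep lt; lia.
- by rewrite ltnn.
Qed.

Lemma stretch_inj l k t t' :
  stretch (2 ^ level l * t.*2.+1) = stretch (2 ^ level k * t'.*2.+1) ->
  2 ^ level l * t.*2.+1 = 2 ^ level k * t'.*2.+1.
Proof.
move: l k t t'; suff lt l k t t' : 2 ^ level l * t.*2.+1 < 2 ^ level k * t'.*2.+1 ->
    stretch (2 ^ level l * t.*2.+1) < stretch (2 ^ level k * t'.*2.+1).
  move=> l k t t' e; case: (ltngtP (2 ^ level l * t.*2.+1) (2 ^ level k * t'.*2.+1)) => // /lt;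
  by rewrite e ltnn.
move=> /stretch_sep.
have m0 : 0 < 2 ^ level l * t.*2.+1 by rewrite muln_gt0 expn_gt0.
have := spacing_ge m0 (dvdn_mulr _ (dvdnn _)); have := gap_gt0 l; lia.
Qed.

Lemma separated_set_disjoint l k n :
  separated_set l n -> separated_set k n -> l = k.
Proof.
move=> /asboolP[t ->] /asboolP[t' /stretch_inj e]; apply: level_inj.
have val i s : logn 2 (2 ^ level i * s.*2.+1) = level i.
  rewrite lognM ?expn_gt0// pfactorK// -[RHS]addn0; congr (_ + _).
  by rewrite lognE dvdn2 /= odd_double.
by rewrite -(val l t) e val.
Qed.

(** The integers [2 ^ level l * (2 * t + 1)] form an arithmetic progression, and
[stretch] is injective on them and at most linear. *)
Lemma separated_set_dense l M :
  M %/ 2 ^ (level l + 3) <= #|[pred n : 'I_M.+1 | separated_set l n]|.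
Proof.
set T := M %/ _.
have bd (t : 'I_T) : stretch (2 ^ level l * t.*2.+1) < M.+1.
  rewrite ltnS (leq_trans (stretch_le _))//.
  apply: leq_trans (leq_trunc_div M (2 ^ (level l + 3))).
  rewrite -/T expnD; have := ltn_ord t; set P := 2 ^ level l.
  move=> tT; rewrite mulnCA [leqRHS]mulnCA leq_mul2l.
  by apply/orP; right; rewrite (_ : 2 ^ 3 = 8)//; lia.
pose f (t : 'I_T) : 'I_M.+1 := Ordinal (bd t).
have fi : injective f.
  move=> t t' /(congr1 val)/= /stretch_inj/eqP; rewrite eqn_pmul2l ?expn_gt0// => /eqP e.
  by apply: val_inj => /=; lia.
rewrite -[X in X <= _]card_ord -(card_imset predT fi).
apply: subset_leq_card; apply/fintype.subsetP => _ /imsetP[t _ ->].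
by apply/asboolP; exists t.
Qed.

End SeparatedSets.

(** * Block-diagonal operators *)

Section EsumSeq.
Variables (R : realType) (T T' : choiceType).
Local Open Scope ereal_scope.

Lemma esum_seq (s : seq T) (F : T -> \bar R) : uniq s -> (forall j, 0 <= F j) ->
  \esum_(j in [set: T]) (if j \in s then F j else 0) = \sum_(j <- s) F j.
Proof.
move=> us F0; rewrite fsbig_seq// -esum_fset ?finite_seq// [RHS]esum_mkcond.
by apply: eq_esum => j _; rewrite mem_setE.
Qed.

Lemma exchange_esum (a : T -> T' -> \bar R) : (forall i j, 0 <= a i j) ->
  \esum_(i in [set: T]) \esum_(j in [set: T']) a i j =
  \esum_(j in [set: T']) \esum_(i in [set: T]) a i j.
Proof.
move=> a0; rewrite !esum_esum//; symmetry.
apply: (@reindex_esum R _ _ _ _ (fun x : T * T' => (x.2, x.1))).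
split => //; first by move=> [x y] [x' y'] _ _ /= [-> ->].
by move=> [x y] _; exists (y, x).
Qed.

End EsumSeq.

Lemma sumr_const_seq (V : nmodType) (I : Type) (r : seq I) (x : V) :
  \sum_(i <- r) x = x *+ size r.
Proof. by rewrite big_const_seq count_predT iter_addr addr0. Qed.

Section ModulusExtra.
Context {R : realType} {k : scalar_kind}.
Notation K := (scalar_field R k).

Lemma modulus_sum (I : Type) (r : seq I) (F : I -> K) :
  modulus (\sum_(i <- r) F i) <= \sum_(i <- r) modulus (F i).
Proof.
elim: r => [|i r IH]; first by rewrite !big_nil modulus0.
by rewrite !big_cons (le_trans (modulusD _ _))// lerD2l.
Qed.

Lemma modulus1 : modulus (1 : K) = 1.
Proof. by apply: (@to_scalar_inj R k); rewrite modulusE normr1 to_scalar1. Qed.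

Lemma modulusN (x : K) : modulus (- x) = modulus x.
Proof. by apply: (@to_scalar_inj R k); rewrite !modulusE normrN. Qed.

Lemma modulusV (x : K) : modulus x^-1 = (modulus x)^-1.
Proof.
have [->|x0] := eqVneq x 0; first by rewrite invr0 modulus0 invr0.
have mx : modulus x != 0 by apply: contraNneq x0 => /modulus0_eq0 ->.
by apply: (mulfI mx); rewrite mulfV// -modulusM divff// modulus1.
Qed.

Lemma modulus_eq0 (x : K) : (modulus x == 0) = (x == 0).
Proof.
by apply/eqP/eqP => [/modulus0_eq0//|->]; rewrite modulus0.
Qed.

Lemma modulus_gt0 (x : K) : (0 < modulus x) = (x != 0).
Proof. by rewrite lt_def modulus_ge0 andbT modulus_eq0. Qed.

Lemma ltr_to_scalar (x y : R) : (to_scalar x < to_scalar y :> K) = (x < y).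
Proof. by rewrite !lt_neqAle ler_to_scalar (inj_eq (@to_scalar_inj R k)). Qed.

Lemma pos_to_scalar (e : K) : 0 < e -> exists2 d : R, 0 < d & e = to_scalar d.
Proof.
move=> e0; exists (modulus e); first by rewrite modulus_gt0 gt_eqF.
by rewrite modulusE gtr0_norm.
Qed.

End ModulusExtra.

Section BlockBound.
Context {R : realType} {k : scalar_kind} {p : R} (p1 : 1 <= p).
Notation K := (scalar_field R k).
Implicit Types (f g : int -> K^o) (x y : lp k p1).

Let p0 : 0 < p. Proof. exact: lt_le_trans p1. Qed.

(** A partition of a set of indices into finite blocks, given by the function
that sends an index to the list of indices in its block; indices outside all blocks
are sent to the empty list. *)
Definition block_system (blk : int -> seq int) : Prop :=
  [/\ forall i, uniq (blk i), forall i j, j \in blk i -> i \in blk j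
    & forall i j, j \in blk i -> size (blk j) = size (blk i)].

(** A sum of [N] terms is at most [N] times its largest term, and the [p]-th power
of the largest term is one of the summands on the right. *)
Lemma powR_sum_le (s : seq int) (e : R) f : 0 <= e ->
  (e / (size s)%:R ^+ 2 * \sum_(j <- s) modulus (f j)) `^ p <=
  \sum_(j <- s) e `^ p / (size s)%:R * modulus (f j) `^ p.
Proof.
move=> e0; have [->|s0] := eqVneq s [::].
  by rewrite !big_nil mulr0 powR0// gt_eqF.
have sz0 : 0 < (size s)%:R :> R by rewrite ltr0n lt0n size_eq0.
have [j0 j0s max] : exists2 j0, j0 \in s & forall j, j \in s -> modulus (f j) <= modulus (f j0).
  elim: s s0 {sz0} => // i s IH _; have [->|s0] := eqVneq s [::].
    by exists i => [|j]; rewrite ?mem_head// inE => /eqP->.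
  have [j js mj] := IH s0; case: (leP (modulus (f i)) (modulus (f j))) => h.
    by exists j => [|l]; rewrite inE ?js ?orbT// => /predU1P[->//|/mj].
  exists i => [|l]; rewrite ?mem_head// inE => /predU1P[->//|/mj] h'.
  exact: le_trans h' (ltW h).
have le0 : e / (size s)%:R ^+ 2 * \sum_(j <- s) modulus (f j) <=
    (size s)%:R^-1 * (e * modulus (f j0)).
  have -> : (size s)%:R^-1 * (e * modulus (f j0)) =
      e / (size s)%:R ^+ 2 * (\sum_(j <- s) modulus (f j0)).
    by rewrite sumr_const_seq -mulr_natr; field; rewrite gt_eqF.
  apply: ler_wpM2l; first by rewrite divr_ge0// exprn_ge0// ltW.
  by rewrite !big_seq; apply: ler_sum => j; exact: max.
apply: (@le_trans _ _ ((size s)%:R^-1 * (e * modulus (f j0)) `^ p)).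
  apply: (@le_trans _ _ (((size s)%:R^-1 * (e * modulus (f j0))) `^ p)).
    apply: ge0_ler_powR; rewrite ?nnegrE ?(ltW p0)//.
      by rewrite mulr_ge0 ?divr_ge0 ?exprn_ge0 ?(ltW sz0)// sumr_ge0// => j _; exact: modulus_ge0.
    by rewrite !mulr_ge0 ?invr_ge0 ?(ltW sz0) ?modulus_ge0.
  apply: ge1r_powRZ => //; last by rewrite mulr_ge0 ?modulus_ge0.
  by rewrite invr_gt0 sz0/= invf_le1// ler1n -(ltr0n R).
rewrite powRM ?modulus_ge0// mulrA (mulrC _^-1).
rewrite (big_rem j0)//= lerDl; apply: sumr_ge0 => j _.
by rewrite !mulr_ge0 ?powR_ge0 ?invr_ge0 ?(ltW sz0).
Qed.

(** The blocks act on disjoint sets of coordinates, so the bounds obtained on each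
of them add up, whatever the number of blocks; exchanging the two sums counts every
coordinate [j] once for each of the [size (blk j)] rows of its block. *)
Lemma lp_sum_block (blk : int -> seq int) (e : R) f g :
  block_system blk -> 0 <= e ->
  (forall i, modulus (f i) <=
     e / (size (blk i))%:R ^+ 2 * \sum_(j <- blk i) modulus (g j)) ->
  (lp_sum p f <= (e `^ p)%:E * lp_sum p g)%E.
Proof.
move=> [ublk sym sz] e0 fg.
pose c i j := if j \in blk i
  then (e `^ p / (size (blk j))%:R * modulus (g j) `^ p)%:E else 0%E.
have c0 i j : (0 <= c i j)%E.
  by rewrite /c; case: ifP => // _; rewrite lee_fin !mulr_ge0 ?powR_ge0 ?invr_ge0.
apply: (@le_trans _ _ (\esum_(i in [set: int]) \esum_(j in [set: int]) c i j)%E).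
  apply: le_esum => i _; rewrite esum_seq//; last first.
    by move=> j; rewrite lee_fin !mulr_ge0 ?powR_ge0 ?invr_ge0.
  rewrite sumEFin lee_fin; apply: (@le_trans _ _ ((e / (size (blk i))%:R ^+ 2 *
      \sum_(j <- blk i) modulus (g j)) `^ p)).
    apply: ge0_ler_powR; rewrite ?nnegrE ?modulus_ge0 ?(ltW p0)//.
    exact: le_trans (modulus_ge0 _) (fg i).
  apply: le_trans (powR_sum_le _ _ e0) _; rewrite le_eqVlt; apply/orP; left; apply/eqP.
  by rewrite big_seq [RHS]big_seq; apply: eq_bigr => j /sz ->.
rewrite exchange_esum// /lp_sum -esumZ ?powR_ge0//; last first.
  by move=> n; rewrite lee_fin powR_ge0.
apply: le_esum => j _.
have cE i : c i j = if i \in blk j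
    then (e `^ p / (size (blk j))%:R * modulus (g j) `^ p)%:E else 0%E.
  by rewrite /c (_ : (j \in blk i) = (i \in blk j))//; apply/idP/idP; exact: sym.
under eq_esum do rewrite cE.
rewrite esum_seq//; last first.
  by move=> i; rewrite lee_fin !mulr_ge0 ?powR_ge0 ?invr_ge0.
rewrite sumEFin lee_fin sumr_const_seq -mulr_natr.
have [->|s0] := eqVneq (size (blk j)) 0%N; first by rewrite mulr0 mulr_ge0 ?powR_ge0.
rewrite le_eqVlt; apply/orP; left; apply/eqP; field.
by rewrite pnatr_eq0.
Qed.

Lemma lp_norm_block (blk : int -> seq int) (e : R) x y :
  block_system blk -> 0 <= e ->
  (forall i, modulus (y i) <=
     e / (size (blk i))%:R ^+ 2 * \sum_(j <- blk i) modulus (x j)) ->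
  lp_norm y <= e * lp_norm x.
Proof.
move=> hb e0 h; apply: lp_norm_le; first by rewrite mulr_ge0 ?lp_norm_ge0.
by apply: le_trans (lp_sum_block hb e0 h) _; rewrite lp_normE -EFinM powRM ?lp_norm_ge0.
Qed.

End BlockBound.

Section BlockOperator.
Context {R : realType} {k : scalar_kind} {p : R} {p1 : 1 <= p}.
Notation K := (scalar_field R k).
Implicit Types (x y : lp k p1) (s : int -> int -> K).

Lemma block_row_le (r : seq int) (c : int -> K) (g : int -> K^o) (M : R) : 0 <= M ->
  (forall j, j \in r -> (size r)%:R ^+ 2 * modulus (c j) <= M) ->
  modulus (\sum_(j <- r) c j * g j) <=
    M / (size r)%:R ^+ 2 * \sum_(j <- r) modulus (g j).
Proof.
move=> M0 cM; have [->|r0] := eqVneq r [::].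
  by rewrite !big_nil mulr0 modulus0.
have sz0 : 0 < (size r)%:R ^+ 2 :> R by rewrite exprn_gt0// ltr0n lt0n size_eq0.
apply: le_trans (modulus_sum _ _) _; rewrite mulr_sumr big_seq [leRHS]big_seq.
apply: ler_sum => j jr; rewrite modulusM ler_wpM2r ?modulus_ge0//.
by rewrite ler_pdivlMr// mulrC cM.
Qed.

Definition mat_apply (blk : int -> seq int) s (x : int -> K^o) : int -> K^o :=
  fun i => \sum_(j <- blk i) s i j * x j.

(** The square of the size of a block times its largest entry is a crude bound for
the norm of the block, uniform in [p]; this is sufficient because all estimates on
the entries are made after the size of the block is known. *)
Definition block_bounded (blk : int -> seq int) s (M : R) : Prop :=
  [/\ block_system blk, 0 <= M
    & forall i j, j \in blk i -> (size (blk i))%:R ^+ 2 * modulus (s i j) <= M].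

Section Op.
Variables (blk : int -> seq int) (s : int -> int -> K) (M : R).
Hypothesis hs : block_bounded blk s M.

Lemma mat_apply_lp x : mat_apply blk s x \in lp_pred k p1.
Proof.
have [hb M0 sM] := hs; rewrite unfold_in.
apply: le_lt_trans (lp_sum_block p1 (g := x) hb M0 _) _.
  by move=> i; apply: block_row_le => // j; exact: sM.
by rewrite lp_normE -EFinM ltry.
Qed.

Definition block_fun x : lp k p1 := Lp (mat_apply_lp x).

Lemma block_fun_norm x : lp_norm (block_fun x) <= M * lp_norm x.
Proof.
have [hb M0 sM] := hs; apply: (lp_norm_block (blk := blk)) => // i.
by apply: block_row_le => // j; exact: sM.
Qed.

Lemma block_fun_bop : block_fun \in bop_pred (lp k p1).
Proof.
apply/asboolP; split.
  move=> c x y; apply/val_inj/funext => i /=; rewrite !fctE /= /mat_apply.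
  rewrite /GRing.scale/= mulr_sumr -big_split/=; apply: eq_bigr => j _.
  by rewrite mulrDr mulrCA.
exists (to_scalar M) => x.
by have := block_fun_norm x; rewrite -(@ler_to_scalar R k) to_scalarM.
Qed.

Definition block_op : bounded_op (lp k p1) := Bop block_fun_bop.

End Op.
End BlockOperator.

(** * Truncations *)

Definition irange (n : nat) : seq int :=
  [seq (t%:Z - n%:Z)%R | t <- iota 0 n.*2.+1].

Lemma mem_irange n (i : int) : (i \in irange n) = (`|i|%N <= n)%N.
Proof.
apply/mapP/idP => [[t]|h]; first by rewrite mem_iota => ? ->; lia.
by exists (absz (i + n%:Z)); rewrite ?mem_iota; lia.
Qed.

Lemma irange_uniq n : uniq (irange n).
Proof. by rewrite map_inj_uniq ?iota_uniq// => t t'; lia. Qed.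

Lemma size_irange n : size (irange n) = n.*2.+1.
Proof. by rewrite size_map size_iota. Qed.

Section Truncation.
Context {R : realType} {k : scalar_kind} {p : R} {p1 : 1 <= p}.
Notation K := (scalar_field R k).
Notation X := (lp k p1).
Implicit Types (x y : X).

Let p0 : 0 < p. Proof. exact: lt_le_trans p1. Qed.

Lemma lp_norm_mono x y : (forall i, modulus (x i) <= modulus (y i)) ->
  lp_norm x <= lp_norm y.
Proof.
move=> xy; apply: lp_norm_le; first exact: lp_norm_ge0.
rewrite -lp_normE; apply: le_esum => i _; rewrite lee_fin.
by apply: ge0_ler_powR; rewrite ?nnegrE ?modulus_ge0 ?(ltW p0).
Qed.

Lemma trunc_weight_bounded n :
  bounded_seq (fun i : int => (`|i|%N <= n)%:R : K).
Proof. by exists 1 => i; case: leqP; rewrite ?modulus1 ?modulus0. Qed.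

(** The projection onto the coordinates in [[-n, n]], as a weighted shift by [0].
It is locked since unification would otherwise unfold it when it compares a vector
with its truncation. *)
Definition trunc n : bounded_op X := locked (wshift 0 (trunc_weight_bounded n)).

Lemma truncE n x i : trunc n x i = if (`|i|%N <= n)%N then x i else 0.
Proof. by rewrite /trunc -lock /= addr0; case: leqP => _; rewrite ?mul1r ?mul0r. Qed.

Lemma lpB x y i : (x - y) i = x i - y i. Proof. by []. Qed.

Lemma lpZ (c : K) x i : (c *: x) i = c * x i. Proof. by []. Qed.

Lemma tailE n x i : (x - trunc n x) i = if (`|i|%N <= n)%N then 0 else x i.
Proof. by rewrite lpB truncE; case: leqP => _; rewrite ?subrr ?subr0. Qed.

Lemma lp_norm_trunc n x : lp_norm (trunc n x) <= lp_norm x.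
Proof.
by apply: lp_norm_mono => i; rewrite truncE; case: leqP; rewrite ?modulus0 ?modulus_ge0.
Qed.

Lemma lp_norm_tail n m x : (n <= m)%N ->
  lp_norm (x - trunc m x) <= lp_norm (x - trunc n x).
Proof.
move=> nm; apply: lp_norm_mono => i; rewrite !tailE.
case: (leqP `|i| m) => im; first by rewrite modulus0 modulus_ge0.
by rewrite leqNgt (leq_ltn_trans nm im).
Qed.

Lemma lp_norm_tail_le n x : lp_norm (x - trunc n x) <= lp_norm x.
Proof.
by apply: lp_norm_mono => i; rewrite tailE; case: leqP; rewrite ?modulus0 ?modulus_ge0.
Qed.

Lemma lp_norm_disjoint x y : (forall i, x i = 0 \/ y i = 0) ->
  lp_norm (x + y) `^ p = lp_norm x `^ p + lp_norm y `^ p.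
Proof.
move=> xy; suff : (lp_sum p (x + y)%R = lp_sum p x + lp_sum p y)%E.
  by rewrite (lp_normE (x + y)) (lp_normE x) (lp_normE y) -EFinD => -[].
rewrite /lp_sum -esumD; last 2 first.
  by move=> i _; rewrite lee_fin powR_ge0.
  by move=> i _; rewrite lee_fin powR_ge0.
apply: eq_esum => i _; rewrite -EFinD; congr EFin.
have [/= e|/= e] := xy i;
  rewrite -[X in modulus X]/(x i + y i) e ?add0r ?addr0 modulus0 powR0 ?gt_eqF//.
  by rewrite add0r.
by rewrite addr0.
Qed.

(** The [p]-th powers of the norms of the two pieces [trunc n x] and
[x - trunc n x] add up to that of [x], and the first one comes close to it because
it dominates a finite partial sum that does. *)
Lemma trunc_cvg x (e : R) : 0 < e -> exists n, lp_norm (x - trunc n x) < e.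
Proof.
move=> e0; have [x0|xn0] := eqVneq (lp_norm x) 0.
  by exists 0%N; apply: le_lt_trans (lp_norm_tail_le _ _) _; rewrite x0.
have ep : 0 < e `^ p by rewrite powR_gt0.
have : (lp_sum p x - (e `^ p)%:E < lp_sum p x)%E.
  by rewrite lp_normE -EFinB lte_fin ltrBlDr ltrDl.
rewrite {2}/lp_sum => /ereal_sup_gt[_ [A [fA _] <-]] hA.
have /finite_seqP[s As] := fA.
pose n := (\max_(i <- s) absz i)%N.
have An i : A i -> (`|i| <= n)%N.
  by rewrite As /= => si; exact: leq_bigmax_seq.
exists n; have tA : (\sum_(i \in A) (modulus (x i) `^ p)%:E <= lp_sum p (trunc n x))%E.
  apply: esum_ge; exists A => //; apply: lee_fsum => // i Ai.
  by rewrite truncE An.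
have e1 : lp_norm x `^ p = lp_norm (trunc n x) `^ p + lp_norm (x - trunc n x) `^ p.
  rewrite -lp_norm_disjoint; first by congr (lp_norm _ `^ p); rewrite addrC subrK.
  by move=> i; rewrite truncE tailE; case: leqP; [right|left].
rewrite (lp_normE (trunc n x)) in tA; rewrite (lp_normE x) in hA.
have h : lp_norm x `^ p - e `^ p < lp_norm (trunc n x) `^ p.
  by rewrite -lte_fin; exact: lt_le_trans hA tA.
have : lp_norm (x - trunc n x) `^ p < e `^ p.
  have aux (u v w z : R) : u - z < v -> u = v + w -> w < z.
    by move=> h' e'; rewrite e' ltrBlDr ltrD2l in h'.
  exact: aux h e1.
move=> h2; rewrite ltNge; apply/negP => le; move: h2; apply/negP; rewrite -leNgt.
apply: ge0_ler_powR; rewrite ?nnegrE ?lp_norm_ge0 ?(ltW p0)//.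
exact: ltW.
Qed.

Lemma lp_norm_basis i : lp_norm (@lp_basis _ k _ p1 i) <= 1.
Proof.
apply: lp_norm_le => //; rewrite powR1 /lp_sum.
rewrite (@eq_esum _ _ _ _ (fun j : int => if j \in [:: i] then 1%:E else 0%E)).
  by rewrite esum_seq// big_seq1.
move=> j _; rewrite inE; case: eqP => [->|/eqP/negbTE ji] /=.
  by rewrite eqxx modulus1 powR1.
by rewrite [j == i]ji modulus0 powR0// gt_eqF.
Qed.

Lemma lp_sum_coord (I : Type) (r : seq I) (F : I -> X) n :
  (\sum_(i <- r) F i) n = \sum_(i <- r) F i n.
Proof. by elim: r => [|i r IH]; rewrite ?big_nil// !big_cons -IH. Qed.

Lemma lp_norm_sum (I : Type) (r : seq I) (F : I -> X) :
  lp_norm (\sum_(i <- r) F i) <= \sum_(i <- r) lp_norm (F i).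
Proof.
elim: r => [|i r IH]; last by rewrite !big_cons (le_trans (lp_normD _ _))// lerD2l.
by rewrite !big_nil lp_norm_le// lp_sum0// lee_fin powR_ge0.
Qed.

Lemma trunc_basis n x : trunc n x = \sum_(i <- irange n) x i *: lp_basis i.
Proof.
apply/val_inj/funext => m; rewrite [LHS]truncE [RHS]lp_sum_coord.
have termE i : (x i *: lp_basis i : X) m = if i == m then x m else 0.
  by rewrite lpZ /= eq_sym; case: eqP => [->|_]; rewrite ?mulr1 ?mulr0.
under eq_bigr do rewrite termE.
rewrite -mem_irange; case: ifP => mi.
  rewrite (bigD1_seq m) ?irange_uniq//= eqxx [X in _ = _ + X]big1 ?addr0//.
  by move=> i /negbTE ->.
rewrite big1_seq// => i /andP[_ ii]; case: eqP => // im.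
by rewrite -im ii in mi.
Qed.

Lemma lp_norm_trunc_sum n x : lp_norm (trunc n x) <= \sum_(i <- irange n) modulus (x i).
Proof.
rewrite trunc_basis; apply: le_trans (lp_norm_sum _ _) _.
apply: ler_sum => i _; rewrite lp_normZ.
by rewrite ler_piMr ?modulus_ge0// lp_norm_basis.
Qed.

End Truncation.

(** * A criterion for compactness *)

Lemma sqrt_sqrD_le (R : rcfType) (x y : R) :
  Num.sqrt (x ^+ 2 + y ^+ 2) <= `|x| + `|y|.
Proof.
rewrite -[leRHS]ger0_norm ?addr_ge0// -(sqrtr_sqr (_ + _)) ler_wsqrtr//.
by rewrite sqrrD !real_normK ?num_real// addrAC lerDl mulrn_wge0// mulr_ge0.
Qed.

(** Only a compact superset of the disc is needed to apply the theorem of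
Tychonoff, and for complex scalars a square is more convenient. *)
Lemma disc_compact (R : realType) (k : scalar_kind) :
  exists B : set (scalar_field R k)^o, compact B /\ forall z, modulus z <= 1 -> B z.
Proof.
have sq := @segment_compact R (- 1) 1.
case: k => /=.
  by exists `[(-1 : R), 1]%classic; split => // z; rewrite /= in_itv/= ler_norml.
pose g (u : R * R) : R[i]^o := (u.1 +i* u.2)%C.
exists (g @` (`[(-1 : R), 1] `*` `[(-1 : R), 1])); split.
  apply: continuous_compact; last exact: compact_setX.
  apply: continuous_subspaceT => u; apply/cvgrPdist_lt => e e0.
  have [d d0 ->] := pos_to_scalar (k := ComplexScalars) e0.
  have d20 : 0 < d / 2 by rewrite divr_gt0.
  exists ([set x | `|u.1 - x| < d / 2], [set y | `|u.2 - y| < d / 2]).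
    by split; apply/nbhs_normP; exists (d / 2).
  move=> [x y] [/= ux uy]; rewrite -(@modulusE R ComplexScalars).
  rewrite (@ltr_to_scalar R ComplexScalars) /=.
  rewrite (_ : d = d / 2 + d / 2); last by field.
  apply: le_lt_trans (ltrD ux uy).
  exact: sqrt_sqrD_le.
move=> [a b] /= ab1; exists (a, b) => //; split => /=; rewrite in_itv/= -ler_norml.
  by rewrite -sqrtr_sqr (le_trans _ ab1)// ler_wsqrtr// lerDl sqr_ge0.
by rewrite -sqrtr_sqr (le_trans _ ab1)// ler_wsqrtr// lerDr sqr_ge0.
Qed.

Section Compactness.
Context {R : realType} {k : scalar_kind} {p : R} {p1 : 1 <= p}.
Notation K := (scalar_field R k).
Notation X := (lp k p1).
Notation P := {ptws int -> K^o}.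

Let p0 : 0 < p. Proof. exact: lt_le_trans p1. Qed.

Lemma nbhs_modulus (z : K^o) (d : R) : 0 < d ->
  nbhs z [set w | modulus (z - w) < d].
Proof.
move=> d0; apply/nbhs_normP; exists (to_scalar d) => /=.
  by rewrite -to_scalar0 ltr_to_scalar.
by move=> w /=; rewrite -modulusE ltr_to_scalar.
Qed.

Lemma near_ptws (f : P) (J : seq int) (d : R) : 0 < d ->
  nbhs f [set g : P | forall j, j \in J -> modulus (f j - g j) < d].
Proof.
move=> d0; elim: J => [|j J IH]; first by apply: filterS filterT => g _ j.
have hj : nbhs f [set g : P | modulus (f j - g j) < d].
  apply: (@proj_continuous int (fun=> K^o) j f [set z | modulus (f j - z) < d]).
  exact: nbhs_modulus.
by apply: filterS2 hj IH => g gj gJ l; rewrite inE => /predU1P[->|/gJ].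
Qed.

Lemma lp_nbhsP (x : X) (U : set X) : nbhs x U <->
  exists2 d : R, 0 < d & forall y, lp_norm (x - y) < d -> U y.
Proof.
split=> [/nbhs_normP[e /= e0 eU]|[d d0 dU]].
  have [d d0 ed] := pos_to_scalar e0; exists d => // y xy; apply: eU => /=.
  by rewrite ed [X in X < _]/(to_scalar _) ltr_to_scalar.
apply/nbhs_normP; exists (to_scalar d) => /=; first by rewrite -to_scalar0 ltr_to_scalar.
by move=> y; rewrite /= [X in X < _]/(to_scalar _) ltr_to_scalar; exact: dU.
Qed.

Lemma finsupp_lp n (f : int -> K^o) :
  (fun i => if (`|i|%N <= n)%N then f i else 0) \in lp_pred k p1.
Proof.
have -> : (fun i => if (`|i|%N <= n)%N then f i else 0) =
    \sum_(j <- irange n) (f j *: lp_basis j : X) :> (int -> K^o).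
  apply/funext => i; rewrite lp_sum_coord.
  under eq_bigr do rewrite lpZ /=.
  rewrite -mem_irange; case: ifP => ii.
    rewrite (bigD1_seq i) ?irange_uniq//= eqxx mulr1 [X in _ = _ + X]big1 ?addr0//.
    by move=> j; rewrite eq_sym => /negbTE ->; rewrite mulr0.
  rewrite big1_seq// => j /andP[_ jj]; case: eqP => [ij|]; rewrite ?mulr0//.
  by rewrite ij jj in ii.
exact: lp_funP.
Qed.

Definition restrict n (f : int -> K^o) : X := Lp (finsupp_lp n f).

(** The unit ball of [l^p], described through truncations so that membership makes
sense for all scalar families and is visibly closed under coordinatewise limits. *)
Definition lp_ball : set P := [set f | forall n, lp_norm (restrict n f) <= 1].

Lemma lp_ball_coord (f : P) i : lp_ball f -> modulus (f i) <= 1.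
Proof.
move=> /(_ `|i|%N) h; apply: le_trans (le_trans (lp_coord_le _ i) h).
by rewrite /= leqnn.
Qed.

Lemma lp_ballP (x : X) : lp_norm x <= 1 -> lp_ball x.
Proof.
move=> x1 n; apply: le_trans x1; apply: lp_norm_mono => i /=.
by case: ifP => // _; rewrite modulus0 modulus_ge0.
Qed.

Lemma lp_ball_lp (f : P) : lp_ball f -> f \in lp_pred k p1.
Proof.
move=> fb; rewrite unfold_in; apply: (@le_lt_trans _ _ 1%E); last exact: ltry.
apply: ge_ereal_sup => _ [A [fA _] <-].
have /finite_seqP[s As] := fA.
pose n := (\max_(i <- s) absz i)%N.
have An i : A i -> (`|i| <= n)%N.
  by rewrite As /= => si; exact: leq_bigmax_seq.
have h : (lp_sum p (restrict n f) <= 1)%E.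
  rewrite lp_normE lee_fin; apply: (@le_trans _ _ (1 `^ p)); last by rewrite powR1.
  by apply: ge0_ler_powR; rewrite ?nnegrE ?lp_norm_ge0 ?(ltW p0).
apply: le_trans h; apply: esum_ge; exists A => //; apply: lee_fsum => // i Ai.
by rewrite /= An.
Qed.

Lemma closed_lp_ball : closed lp_ball.
Proof.
move=> f cf n; apply/ler_addgt0Pr => e e0.
have d0 : 0 < e / (n.*2.+1)%:R by rewrite divr_gt0.
have [g [gb /= gn]] := cf _ (near_ptws f (irange n) d0).
rewrite -[restrict n f](subrK (restrict n g)) addrC.
apply: le_trans (lp_normD _ _) _; apply: lerD => //.
have -> : restrict n f - restrict n g = trunc n (restrict n f - restrict n g).
  apply/val_inj/funext => i; rewrite [RHS]truncE; case: ifP => //= h.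
  by rewrite !fctE /= h subrr.
apply: le_trans (lp_norm_trunc_sum _ _) _.
rewrite (_ : e = \sum_(i <- irange n) e / (n.*2.+1)%:R); last first.
  by rewrite sumr_const_seq size_irange -[RHS]mulr_natr divfK// pnatr_eq0.
rewrite big_seq [leRHS]big_seq; apply: ler_sum => i ii.
move: (ii); rewrite mem_irange lpB /= => ->; exact/ltW/gn.
Qed.

Lemma compact_lp_ball : compact lp_ball.
Proof.
have [B [cB hB]] := disc_compact R k.
apply: (@subclosed_compact _ _ [set f : P | forall i, B (f i)]) closed_lp_ball _ _.
  exact: (@tychonoff int (fun=> K^o) (fun=> B)).
by move=> f fb i; apply: hB; exact: lp_ball_coord.
Qed.

(** On the unit ball such an operator is continuous from the topology of
coordinatewise convergence to the norm topology: up to a uniformly small tail, the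
image is described by finitely many coordinates, each of which depends on finitely
many coordinates of the argument.  The ball being compact for the former topology,
its image is compact.  This avoids the completeness of [l^p]. *)
Lemma compact_of_tails (T : bounded_op X) :
  (forall e : R, 0 < e -> exists n, forall x : X,
     lp_norm (T x - trunc n (T x)) <= e * lp_norm x) ->
  (forall i, exists (J : seq int) (c : int -> K), forall x : X,
     T x i = \sum_(j <- J) c j * x j) ->
  T \in cop_pred X.
Proof.
move=> tails rows; apply/asboolP.
(* The topology of coordinatewise convergence lives on all families, hence the
   extension of [T] by zero outside [l^p]. *)
pose ext (f : P) : X := if pselect (f \in lp_pred k p1) is left h then T (Lp h) else 0.
have extE (f : P) (h : f \in lp_pred k p1) : ext f = T (Lp h).
  rewrite /ext; case: pselect => // h'; congr (T _); exact: val_inj.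
apply: (@precompact_subset _ _ (ext @` lp_ball)).
  move=> _ [x /= x1 <-]; exists (x : int -> K^o).
    apply: lp_ballP; move: x1; rewrite -(@to_scalar1 R k).
    by rewrite [X in X <= _]/(to_scalar _) ler_to_scalar.
  by rewrite (extE _ (lp_funP x)); congr (T _); exact: val_inj.
apply: compact_precompact; first exact: norm_hausdorff.
apply: continuous_compact compact_lp_ball.
apply/subspace_continuousP => f fb U /lp_nbhsP[d d0 dU].
have [n nT] := tails (d / 4) (divr_gt0 d0 (ltr0n _ 4)).
have d20 : 0 < d / 2 by rewrite divr_gt0.
have dd : d / 2 + d / 4 < d by lra.
have norm1 (h : P) (hb : lp_ball h) : lp_norm (Lp (lp_ball_lp hb) : X) <= 1.
  apply/ler_addgt0Pr => e e0; have [m hm] := trunc_cvg (Lp (lp_ball_lp hb) : X) e0.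
  rewrite -[X in lp_norm X](subrK (trunc m (Lp (lp_ball_lp hb)))) addrC.
  apply: le_trans (lp_normD _ _) _; apply: lerD; last exact: ltW.
  apply: le_trans (hb m); apply: lp_norm_mono => i; rewrite truncE /=.
  by case: ifP.
have step (I : seq int) (d' : R) : 0 < d' -> exists (J : seq int) (e : R), 0 < e /\
  forall g (gb : lp_ball g), (forall j, j \in J -> modulus (f j - g j) < e) ->
   \sum_(i <- I) modulus (T (Lp (lp_ball_lp fb) - Lp (lp_ball_lp gb)) i) <= d'.
  elim: I d' => [|i I IH] d' d'0.
    by exists [::], 1; split => // g gb _; rewrite big_nil ltW.
  have d'20 : 0 < d' / 2 by rewrite divr_gt0.
  have [J [e [e0 He]]] := IH _ d'20.
  have [J' [c cT]] := rows i.
  have s0 : 0 < \sum_(j <- J') modulus (c j) + 1.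
    by rewrite ltr_wpDl// sumr_ge0// => j _; exact: modulus_ge0.
  exists (J ++ J'), (Num.min e (d' / 2 / (\sum_(j <- J') modulus (c j) + 1))); split.
    by rewrite lt_min e0 divr_gt0.
  move=> g gb hg; rewrite big_cons [leRHS](splitr d'); apply: lerD; last first.
    by apply: He => j jJ; have := hg j; rewrite mem_cat jJ lt_min => /(_ isT)/andP[].
  rewrite cT; apply: le_trans (modulus_sum _ _) _.
  apply: (@le_trans _ _ (\sum_(j <- J')
      modulus (c j) * (d' / 2 / (\sum_(j <- J') modulus (c j) + 1)))).
    rewrite big_seq [leRHS]big_seq; apply: ler_sum => j jJ.
    rewrite modulusM ler_wpM2l ?modulus_ge0//; apply/ltW.
    by have := hg j; rewrite mem_cat jJ orbT lt_min => /(_ isT)/andP[].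
  rewrite -mulr_suml mulrCA ler_piMr ?(ltW d'20)//.
  by rewrite ler_pdivrMr// mul1r lerDl.
have [J [e [e0 He]]] := step (irange n) _ (divr_gt0 d0 (ltr0n _ 4)).
have := near_ptws f J e0; rewrite nbhs_simpl /= /within /=.
apply: filterS => g /= gJ gb; apply: dU.
rewrite /from_subspace (extE _ (lp_ball_lp fb)) (extE _ (lp_ball_lp gb)).
set h : X := Lp (lp_ball_lp fb) - Lp (lp_ball_lp gb).
have -> : T (Lp (lp_ball_lp fb)) - T (Lp (lp_ball_lp gb)) = T h by rewrite /h raddfB.
rewrite -[T h](subrK (trunc n (T h))).
have hd : lp_norm h <= 2.
  apply: le_trans (lp_normD _ _) _; rewrite (_ : 2 = 1 + 1)//; apply: lerD => //.
  by rewrite -scaleN1r lp_normZ modulusN modulus1 mul1r.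
have h1 : lp_norm (T h - trunc n (T h)) <= d / 2.
  apply: le_trans (nT h) _; apply: le_trans (_ : _ <= d / 4 * 2) _; last lra.
  by rewrite ler_wpM2l// divr_ge0// ltW.
have h2 : lp_norm (trunc n (T h)) <= d / 4.
  by apply: le_trans (lp_norm_trunc_sum _ _) _; exact: He.
apply: le_lt_trans (lp_normD _ _) _; apply: le_lt_trans (lerD h1 h2) dd.
Qed.

End Compactness.

Section BlockCompact.
Context {R : realType} {k : scalar_kind} {p : R} {p1 : 1 <= p}.
Notation K := (scalar_field R k).
Notation X := (lp k p1).

Lemma block_op_compact blk (s : int -> int -> K) (M : R) (hs : block_bounded blk s M) :
  (forall e : R, 0 < e -> exists n, forall i j, (n < `|i|)%N -> j \in blk i ->
     (size (blk i))%:R ^+ 2 * modulus (s i j) <= e) ->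
  (block_op hs : bounded_op X) \in cop_pred X.
Proof.
move=> van; apply: compact_of_tails => [e e0|i]; last by exists (blk i), (s i).
have [n hn] := van e e0; exists n => x; have [hb _ _] := hs.
apply: (lp_norm_block (blk := blk)) (ltW e0) _ => // i; rewrite tailE.
case: leqP => ni; last by apply: block_row_le (ltW e0) _ => j; exact: hn.
rewrite modulus0 mulr_ge0 ?divr_ge0 ?exprn_ge0 ?(ltW e0)//.
by rewrite sumr_ge0// => j _; exact: modulus_ge0.
Qed.

(** The single block [[-n, n]]. *)
Definition square_block (n : nat) (i : int) : seq int :=
  if (`|i|%N <= n)%N then irange n else [::].

Lemma square_block_system n : block_system (square_block n).
Proof.
split=> [i|i j|i j]; rewrite /square_block.
- by case: ifP => // _; exact: irange_uniq.
- by case: ifP => // ii; rewrite mem_irange => ->; rewrite mem_irange.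
- by case: ifP => // ii; rewrite mem_irange => ->.
Qed.

Lemma square_block_bounded n (c : int -> int -> K) (M : R) : 0 <= M ->
  (forall i j, (`|i|%N <= n)%N -> (`|j|%N <= n)%N ->
     (n.*2.+1)%:R ^+ 2 * modulus (c i j) <= M) ->
  block_bounded (square_block n) c M.
Proof.
move=> M0 cM; split => // [|i j]; first exact: square_block_system.
rewrite /square_block; case: ifP => // ii; rewrite mem_irange size_irange => jj.
exact: cM.
Qed.

Lemma square_block_bound n (c : int -> int -> K) :
  block_bounded (square_block n) c
    ((n.*2.+1)%:R ^+ 2 * \sum_(i <- irange n) \sum_(j <- irange n) modulus (c i j)).
Proof.
apply: square_block_bounded => [|i j ii jj].
  by rewrite mulr_ge0// sumr_ge0// => i _; rewrite sumr_ge0// => j _; exact: modulus_ge0.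
rewrite ler_wpM2l// (bigD1_seq i) ?irange_uniq ?mem_irange//=.
rewrite (bigD1_seq j) ?irange_uniq ?mem_irange//= -addrA lerDl addr_ge0// sumr_ge0// => l _.
  exact: modulus_ge0.
by rewrite sumr_ge0// => j' _; exact: modulus_ge0.
Qed.

Lemma fin_op_compact n (c : int -> int -> K) :
  (block_op (square_block_bound n c) : bounded_op X) \in cop_pred X.
Proof.
apply: block_op_compact => e e0; exists n => i j ni.
by rewrite /square_block leqNgt ni.
Qed.

Definition fin_op n (c : int -> int -> K) : compact_op X := Cop (fin_op_compact n c).

Lemma fin_opE n c (x : X) i : fin_op n c x i =
  if (`|i|%N <= n)%N then \sum_(j <- irange n) c i j * x j else 0.
Proof. by rewrite /= /mat_apply /square_block; case: ifP; rewrite ?big_nil. Qed.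

Lemma fin_op_near n c c' (x : X) (e : R) : 0 <= e ->
  (forall i j, (`|i|%N <= n)%N -> (`|j|%N <= n)%N ->
     (n.*2.+1)%:R ^+ 2 * modulus (c i j - c' i j) <= e) ->
  lp_norm (fin_op n c x - fin_op n c' x) <= e * lp_norm x.
Proof.
move=> e0 cc'; have hb := @square_block_bounded n (fun i j => c i j - c' i j) e e0 cc'.
have -> : fin_op n c x - fin_op n c' x = block_fun hb x; last exact: block_fun_norm.
apply/val_inj/funext => i /=; rewrite !fctE /= /mat_apply -sumrB.
by apply: eq_bigr => j _; rewrite mulrBl.
Qed.

End BlockCompact.

(** * Products of weights *)

Lemma nat_prod_neq0 (F : fieldType) (f : nat -> F) (m n : nat) :
  (forall t, f t != 0) -> \prod_(m <= t < n) f t != 0.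
Proof.
move=> f0; apply: (big_ind (fun x : F => x != 0)) => //; first exact: oner_neq0.
by move=> x y; exact: mulf_neq0.
Qed.

Section Weights.
Context {R : realType} {k : scalar_kind} (a b : int -> scalar_field R k).
Notation K := (scalar_field R k).

(** The factor that multiplies the entry at [(i + m, j + m)] when it is moved to
[(i, j)] by the [m]-th iterate. *)
Definition weight_prod (i j : int) (m : nat) : K :=
  \prod_(0 <= t < m) (a (i + t%:Z + 1) * b (j + t%:Z)).

Lemma weight_prodD i j m m' :
  weight_prod i j (m + m') = weight_prod i j m * weight_prod (i + m%:Z) (j + m%:Z) m'.
Proof.
rewrite /weight_prod (@big_cat_nat _ _ _ m)//= ?leq_addr//; congr (_ * _).
rewrite -{1}[m]add0n big_addn addKn; apply: eq_bigr => t _.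
by rewrite PoszD !addrA !(addrAC _ t%:Z).
Qed.

Lemma weight_prodS i j m :
  weight_prod i j m.+1 = a (i + 1) * b j * weight_prod (i + 1) (j + 1) m.
Proof.
rewrite -add1n weight_prodD; congr (_ * _).
by rewrite /weight_prod big_nat1 !addr0.
Qed.

Lemma weight_prod_split i j m : weight_prod i j m =
  (\prod_(0 <= t < m) a (i + t%:Z + 1)) * (\prod_(0 <= t < m) b (j + t%:Z)).
Proof. exact: big_split. Qed.

Hypothesis a0 : forall n, a n != 0.
Hypothesis b0 : forall n, b n != 0.

Lemma weight_prod_neq0 i j m : weight_prod i j m != 0.
Proof. by apply: nat_prod_neq0 => t; rewrite mulf_neq0. Qed.

(** For large [s] the two products run over the same indices except for a fixed
finite set of them, whose contribution is the constant. *)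
Lemma prod_up_const (w : int -> K) (i : int) : (forall n, w n != 0) ->
  exists2 c, c != 0 & forall s : nat, (`|i| < s)%N ->
    \prod_(0 <= t < s) w (i + t%:Z + 1) = c * prod_up w (s%:Z + i).
Proof.
move=> w0; have up0 u : prod_up w u != 0 by exact: nat_prod_neq0.
(* From [s0] on, [s + i] is positive, so that [prod_up] is the intended product. *)
pose s0 := `|i|%N.+1.
exists ((\prod_(0 <= t < s0) w (i + t%:Z + 1)) / prod_up w (s0%:Z + i)).
  by rewrite mulf_neq0 ?invr_neq0//; exact: nat_prod_neq0.
elim => // s IH; rewrite leq_eqVlt => /predU1P[<-|]; first by rewrite divfK.
rewrite ltnS => si; rewrite big_nat_recr//= IH// -mulrA; congr (_ * _).
rewrite /prod_up; have -> : absz (s.+1%:Z + i) = (absz (s%:Z + i)).+1 by lia.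
by rewrite [RHS]big_nat_recr//=; congr (_ * w _); lia.
Qed.

Lemma weight_prod_up i j : exists2 C : R, 0 < C & forall s : nat,
  (`|i| < s)%N -> (`|j - 1| < s)%N ->
  modulus (weight_prod i j s) =
  C * modulus (prod_up a (s%:Z + i) * prod_up b (s%:Z + (j - 1))).
Proof.
have [c c0 hc] := prod_up_const i a0; have [d d0 hd] := prod_up_const (j - 1) b0.
exists (modulus (c * d)); first by rewrite modulus_gt0 mulf_neq0.
move=> s si sj; rewrite -modulusM weight_prod_split hc//.
have := hd s sj; rewrite (eq_bigr (fun t : nat => b (j + t%:Z))) => [->|t _].
  by rewrite mulrACA.
by congr b; lia.
Qed.

Lemma weight_prod_down i j l :
  weight_prod (i - l%:Z) (j - l%:Z) l = prod_down a i l * prod_down b (j - 1) l.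
Proof.
rewrite weight_prod_split /prod_down; congr (_ * _); rewrite big_nat_rev/= add0n;
  apply: eq_big_nat => t /andP[_ tl]; [congr a|congr b]; lia.
Qed.

End Weights.

(** The first limit, for products that start at [i + 1] and [j] instead of [1]. *)
Definition weights_grow (R : realType) (k : scalar_kind) (q : nat)
    (a b : int -> scalar_field R k) : Prop :=
  forall i j (M : R), exists N, forall n r, (N <= n)%N ->
    M < modulus (weight_prod a b i j ((n + r) ^ q - r ^ q)%N).

(** The second limit: going down by [l] from [(i, j)] is going up by [l] from
[(i - l, j - l)]. *)
Definition weights_decay (R : realType) (k : scalar_kind) (q : nat)
    (a b : int -> scalar_field R k) : Prop :=
  forall i j (e : R), 0 < e -> exists N, forall n r, (N <= n)%N -> (n <= r)%N ->
    let l := (r ^ q - (r - n) ^ q)%N in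
    modulus (weight_prod a b (i - l%:Z) (j - l%:Z) l) < e.

Section Iterates.
Context {R : realType} {k : scalar_kind} {p : R} {p1 : 1 <= p}.
Notation K := (scalar_field R k).
Notation X := (lp k p1).
Variables (a b : int -> K) (ha : bounded_seq a) (hb : bounded_seq b).

(** Conjugating by the shifts moves each entry one step up its diagonal and
multiplies it by one factor of each weight. *)
Lemma iter_C_map_coord (blk : int -> seq int) (s : int -> int -> K)
    (S : bounded_op X) (m : nat) (x : X) (i : int) :
  (forall y l, S y l = \sum_(j <- blk l) s l j * y j) ->
  iter m (C_map (backward_shift p1 ha) (forward_shift p1 hb)) S x i =
  \sum_(j <- blk (i + m%:Z)) weight_prod a b i (j - m%:Z) m * s (i + m%:Z) j * x (j - m%:Z).
Proof.
move=> SE; elim: m x i => [|m IH] x i.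
  rewrite /= SE addr0; apply: eq_bigr => j _.
  by rewrite subr0 /weight_prod big_geq// mul1r.
rewrite iterS.
have -> : forall T : bounded_op X,
    C_map (backward_shift p1 ha) (forward_shift p1 hb) T x i =
    a (i + 1) * T (forward_shift p1 hb x) (i + 1) by [].
rewrite IH mulr_sumr (_ : i + 1 + m%:Z = i + m.+1%:Z); last lia.
apply: eq_bigr => j _.
have -> : forall l, forward_shift p1 hb x l = b (l - 1) * x (l - 1) by [].
rewrite weight_prodS (_ : j - m%:Z - 1 = j - m.+1%:Z); last lia.
rewrite (_ : j - m.+1%:Z + 1 = j - m%:Z); last lia.
by ring.
Qed.

Lemma iter_C_cop (S : compact_op X) m :
  cop_bop (iter m (C_cop (backward_shift p1 ha) (forward_shift p1 hb)) S) =
  iter m (C_map (backward_shift p1 ha) (forward_shift p1 hb)) (cop_bop S).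
Proof. by elim: m => //= m ->. Qed.

End Iterates.

(** * The block-diagonal operator and its orbit *)

Lemma uniform_bound (I : eqType) (s : seq I) (Q : I -> nat -> Prop) :
  (forall i N N', (N <= N')%N -> Q i N -> Q i N') ->
  (forall i, exists N, Q i N) -> exists N, forall i, i \in s -> Q i N.
Proof.
move=> mono ex; elim: s => [|i s [N IH]]; first by exists 0%N.
have [N' h] := ex i; exists (maxn N N') => j; rewrite inE => /predU1P[->|/IH].
  by apply: mono h; exact: leq_maxr.
by apply: mono; exact: leq_maxl.
Qed.

Lemma expn_diff q n r : (0 < q)%N -> (n <= r)%N -> (n ^ q + (r - n) <= r ^ q)%N.
Proof.
move=> q0 /subnKC {2}<-; elim: (r - n)%N => [|d IH]; first by rewrite !addn0.
by rewrite !addnS (leq_ltn_trans IH)// ltn_exp2r.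
Qed.

Section Construction.
Context {R : realType} {k : scalar_kind}.
Notation K := (scalar_field R k).
Variables (q : nat) (a b : int -> K) (rho : nat -> nat) (c : nat -> int -> int -> K).
Hypothesis q0 : (0 < q)%N.
Hypothesis a0 : forall n, a n != 0.
Hypothesis b0 : forall n, b n != 0.
Hypothesis growth : weights_grow q a b.
Hypothesis decay : weights_decay q a b.

(** The weight carried by the entry [(i, j)] of the copy prepared for the time
[n ^ q] when it is seen at the time [r ^ q], see [transferE]. *)
Definition transfer (i j : int) (n r : nat) : K :=
  if (r <= n)%N then (weight_prod a b i j (n ^ q - r ^ q)%N)^-1
  else weight_prod a b (i - (r ^ q - n ^ q)%N%:Z) (j - (r ^ q - n ^ q)%N%:Z) (r ^ q - n ^ q)%N.

(** Both products run over the same indices, up to a common part that cancels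
because [weight_prod] is multiplicative. *)
Lemma transferE i j n r :
  weight_prod a b (i + (n ^ q)%N%:Z - (r ^ q)%N%:Z) (j + (n ^ q)%N%:Z - (r ^ q)%N%:Z) (r ^ q) /
    weight_prod a b i j (n ^ q) = transfer i j n r.
Proof.
rewrite /transfer; case: leqP => rn.
  have rnq : (r ^ q <= n ^ q)%N by rewrite leq_exp2r.
  have -> : weight_prod a b i j (n ^ q) =
      weight_prod a b i j (n ^ q - r ^ q) *
      weight_prod a b (i + (n ^ q - r ^ q)%N%:Z) (j + (n ^ q - r ^ q)%N%:Z) (r ^ q).
    by rewrite -weight_prodD subnK.
  rewrite -!addrA subzn// invfM mulrCA mulfV ?mulr1//.
  exact: weight_prod_neq0.
have rnq : (n ^ q <= r ^ q)%N by rewrite leq_exp2r// ltnW.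
have e (l : int) : l + (n ^ q)%N%:Z - (r ^ q)%N%:Z = l - (r ^ q - n ^ q)%N%:Z by lia.
rewrite !e -{3}(subnK rnq) weight_prodD !subrK mulfK//.
exact: weight_prod_neq0.
Qed.

Definition far (N n r : nat) : Prop := (N + n <= r)%N \/ (N + r <= n)%N.

Lemma far_mono N N' n r : (N <= N')%N -> far N' n r -> far N n r.
Proof. by rewrite /far => NN' [h|h]; [left|right]; apply: leq_trans h; rewrite leq_add2r. Qed.

Lemma transfer_small i j (e : R) : 0 < e ->
  exists N, forall n r, far N n r -> modulus (transfer i j n r) <= e.
Proof.
move=> e0; have [N hN] := growth i j e^-1; have [N' hN'] := decay i j e0.
exists (maxn (maxn N N') 1) => n r h; rewrite /transfer; case: leqP => rn.
  have nN : (N <= n - r)%N by move: h; rewrite /far !maxnE; lia.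
  have := hN _ r nN; rewrite subnK// modulusV => h1.
  rewrite -[e]invrK lef_pV2 ?posrE ?invr_gt0//; first exact: ltW.
  by apply: lt_trans h1; rewrite invr_gt0.
have nN : (N' <= r - n)%N by move: h; rewrite /far !maxnE; lia.
have := hN' _ r nN (leq_subr _ _); rewrite subKn ?(ltnW rn)//= => h1.
exact: ltW.
Qed.

Definition block_small (l : nat) (e : R) (n r : nat) : Prop :=
  forall i j, (`|i|%N <= rho l)%N -> (`|j|%N <= rho l)%N ->
    ((rho l).*2.+1)%:R ^+ 2 * modulus (c l i j * transfer i j n r) <= e.

Lemma block_small_far l (e : R) : 0 < e ->
  exists N, forall n r, far N n r -> block_small l e n r.
Proof.
move=> e0.
pose Q (ij : int * int) N := forall n r, far N n r ->
  ((rho l).*2.+1)%:R ^+ 2 * modulus (c l ij.1 ij.2 * transfer ij.1 ij.2 n r) <= e.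
have [||N hN] := @uniform_bound _ [seq (i, j) | i <- irange (rho l), j <- irange (rho l)] Q.
- by move=> ij N N' NN' h n r f; apply: h; exact: far_mono f.
- move=> [i j]; set C := ((rho l).*2.+1)%:R ^+ 2 * modulus (c l i j).
  have C0 : 0 <= C by rewrite mulr_ge0 ?modulus_ge0// exprn_ge0.
  have C1 : 0 < C + 1 by rewrite ltr_wpDl.
  have [N hN] := transfer_small i j (divr_gt0 e0 C1).
  exists N => n r f /=; rewrite modulusM mulrA -/C.
  apply: le_trans (ler_wpM2l C0 (hN n r f)) _.
  by rewrite mulrCA ler_piMr ?(ltW e0)// ler_pdivrMr// mul1r lerDl.
- exists N => n r f i j ii jj; apply: (hN (i, j)) f.
  by apply/allpairsP; exists (i, j); rewrite !mem_irange.
Qed.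

(** The gap of [l] has to deal with the finitely many matrices of index at most [l]
only: the times of two copies differ by at least both of their gaps, and the gap of
the larger index makes the entries small. *)
Lemma gap_exists : exists gap : nat -> nat, forall l, (rho l < gap l)%N /\
  forall l', (l' <= l)%N -> forall n r, far (gap l) n r -> block_small l' l.+1%:R^-1 n r.
Proof.
suff H l : exists N, (rho l < N)%N /\
    forall l', (l' <= l)%N -> forall n r, far N n r -> block_small l' l.+1%:R^-1 n r.
  by have [gap hgap] := choice H; exists gap.
have [||N hN] := @uniform_bound _ (iota 0 l.+1)
    (fun l' N => forall n r, far N n r -> block_small l' l.+1%:R^-1 n r).
- by move=> i N N' NN' h n r f; apply: h; exact: far_mono f.
- by move=> i; apply: block_small_far.
- exists (maxn N (rho l).+1); split => [|l' l'l n r f]; first exact: leq_maxr.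
  by apply: hN (far_mono (leq_maxl _ _) f); rewrite mem_iota.
Qed.

Section WithGap.
Variable gap : nat -> nat.
Hypothesis rho_gap : forall l, (rho l < gap l)%N.
Hypothesis gap_small : forall l l', (l' <= l)%N -> forall n r, far (gap l) n r ->
  block_small l' l.+1%:R^-1 n r.

Let A := separated_set gap.

Let gap_gt0 l : (0 < gap l)%N. Proof. exact: leq_ltn_trans (rho_gap l). Qed.

Definition in_block (i : int) (u : nat * nat) : Prop :=
  A u.1 u.2 /\ (`|i - (u.2 ^ q)%N%:Z|%N <= rho u.1)%N.

Lemma separated_far l l' n r : A l n -> A l' r -> n != r -> far (gap l + gap l') n r.
Proof.
move=> An Ar; rewrite neq_ltn => /orP[] h; [left|right].
  by rewrite addnC; exact: separated_set_sep h.
by rewrite addnC (addnC (gap l)); exact: separated_set_sep h.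
Qed.

(** Consecutive powers [n ^ q] are at least as far apart as the integers [n]
themselves, and the gaps exceed the radii of the blocks. *)
Lemma in_block_inj i u v : in_block i u -> in_block i v -> u = v.
Proof.
move: u v => [l n] [l' r] [/= An In] [/= Ar Ir].
have [nr|nr] := eqVneq n r.
  by rewrite nr in An *; rewrite (separated_set_disjoint gap_gt0 An Ar).
have := separated_far An Ar nr; rewrite /far.
have := rho_gap l; have := rho_gap l'.
have [rn|rn] := leqP r n.
  by have := expn_diff q0 rn; lia.
by have := expn_diff q0 (ltnW rn); lia.
Qed.

(** The block containing the row [i], as the pair [(l, n)] of a matrix index and
an element [n] of the corresponding set; there is at most one by
[in_block_inj]. *)
Definition center (i : int) : option (nat * nat) :=
  if pselect (exists u, in_block i u) is left h then Some (projT1 (cid h)) else None.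

Lemma center_some i u : center i = Some u -> in_block i u.
Proof. by rewrite /center; case: pselect => // h [<-]; exact: (projT2 (cid h)). Qed.

Lemma centerE i u : in_block i u -> center i = Some u.
Proof.
move=> iu; rewrite /center; case: pselect => [h|]; last by case; exists u.
by congr Some; apply: in_block_inj iu; exact: (projT2 (cid h)).
Qed.

Definition orbit_block (i : int) : seq int :=
  if center i is Some (l, n) then [seq (n ^ q)%N%:Z + t | t <- irange (rho l)] else [::].

Definition orbit_coef (i j : int) : K :=
  if center i is Some (l, n) then
    c l (i - (n ^ q)%N%:Z) (j - (n ^ q)%N%:Z) /
      weight_prod a b (i - (n ^ q)%N%:Z) (j - (n ^ q)%N%:Z) (n ^ q)
  else 0.

Lemma mem_orbit_block i j : j \in orbit_block i -> exists l n,
  [/\ center i = Some (l, n), A l n, (`|i - (n ^ q)%N%:Z|%N <= rho l)%N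
    & (`|j - (n ^ q)%N%:Z|%N <= rho l)%N].
Proof.
rewrite /orbit_block; case e : center => [[l n]|//] /mapP[t].
rewrite mem_irange => ht ->; exists l, n; have [An In] := center_some e.
by split => //; rewrite addrC addKr.
Qed.

Lemma mem_orbit_blockE l n j :
  (j \in [seq (n ^ q)%N%:Z + t | t <- irange (rho l)]) = (`|j - (n ^ q)%N%:Z|%N <= rho l)%N.
Proof.
rewrite -mem_irange; apply/mapP/idP => [[t ht ->]|h].
  by rewrite addrC addKr.
by exists (j - (n ^ q)%N%:Z) => //; rewrite addrC subrK.
Qed.

Lemma orbit_block_system : block_system orbit_block.
Proof.
split=> [i|i j ji|i j ji].
- rewrite /orbit_block; case: center => [[l n]|//].
  by rewrite map_inj_uniq ?irange_uniq//; exact: addrI.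
- have [l [n [_ An In jn]]] := mem_orbit_block ji.
  by rewrite /orbit_block (centerE (conj An jn : in_block j (l, n))) mem_orbit_blockE.
- have [l [n [ci An In jn]]] := mem_orbit_block ji.
  by rewrite /orbit_block (centerE (conj An jn : in_block j (l, n))) ci.
Qed.

Lemma size_orbit_block i l n : center i = Some (l, n) -> size (orbit_block i) = (rho l).*2.+1.
Proof. by rewrite /orbit_block => ->; rewrite size_map size_irange. Qed.

Lemma transfer0 i j n : transfer i j n 0 = (weight_prod a b i j (n ^ q))^-1.
Proof. by rewrite /transfer leq0n exp0n// subn0. Qed.

Lemma orbit_coef_le i j l n (e : R) : center i = Some (l, n) -> block_small l e n 0 ->
  j \in orbit_block i -> (size (orbit_block i))%:R ^+ 2 * modulus (orbit_coef i j) <= e.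
Proof.
move=> ci hs ji; have [l' [n' [ci' An In jn]]] := mem_orbit_block ji.
move: ci'; rewrite ci => -[? ?]; subst l' n'.
rewrite (size_orbit_block ci) /orbit_coef ci -transfer0; exact: hs.
Qed.

Lemma orbit_bounded : block_bounded orbit_block orbit_coef 1.
Proof.
split => //; first exact: orbit_block_system.
move=> i j ji; have [l [n [ci An In jn]]] := mem_orbit_block ji.
apply: (@le_trans _ _ l.+1%:R^-1); last by rewrite invf_le1// ler1n.
apply: orbit_coef_le ci _ ji; apply: gap_small => //; right.
by rewrite addn0; exact: separated_set_ge An.
Qed.

(** Copies of large index are small because the gaps are; for each of the finitely
many other indices, copies far along the diagonal are small by the growth of the
weights. *)
Lemma orbit_vanish (e : R) : 0 < e -> exists m, forall i j, (m < `|i|)%N ->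
  j \in orbit_block i -> (size (orbit_block i))%:R ^+ 2 * modulus (orbit_coef i j) <= e.
Proof.
move=> e0; pose L := (Num.truncn e^-1).+1.
have Le l : (L <= l)%N -> l.+1%:R^-1 <= e.
  move=> Ll; rewrite -[e]invrK lef_pV2 ?posrE ?invr_gt0//.
  apply: ltW; apply: lt_trans (truncnS_gt _) _.
  by rewrite ltr_nat ltnS.
have [||N hN] := @uniform_bound _ (iota 0 L) (fun l N => forall n r, far N n r -> block_small l e n r).
- by move=> i N N' NN' h n r f; apply: h; exact: far_mono f.
- by move=> i; exact: block_small_far.
exists (N ^ q + \sum_(l < L) rho l)%N => i j mi ji.
have [l [n [ci An In jn]]] := mem_orbit_block ji.
apply: orbit_coef_le ci _ ji; have [Ll|lL] := leqP L l.
  move=> i' j' ii jj; apply: le_trans (Le _ Ll); move: i' j' ii jj.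
  apply: gap_small => //; right.
  by rewrite addn0; exact: separated_set_ge An.
apply: hN; first by rewrite mem_iota.
right; rewrite addn0 leqNgt; apply/negP => nN.
have : (n ^ q <= N ^ q)%N by rewrite leq_exp2r// ltnW.
have : (rho l <= \sum_(l < L) rho l)%N by rewrite (bigD1 (Ordinal lL))//= leq_addr.
lia.
Qed.

Context {p : R} {p1 : 1 <= p}.
Notation X := (lp k p1).
Variables (ha : bounded_seq a) (hb : bounded_seq b).

Definition orbit_op : compact_op X :=
  Cop (@block_op_compact R k p p1 _ _ _ orbit_bounded orbit_vanish).

(** At the time [r ^ q] the copy attached to [r] has become the matrix [F_l], and
every other copy is small by the choice of the gaps.  The estimate is made after a
translation by [r ^ q], which brings the blocks back to their original place. *)
Lemma orbit_op_hits l r (x : X) : A l r ->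
  lp_norm (iter (r ^ q) (C_map (backward_shift p1 ha) (forward_shift p1 hb)) orbit_op x
           - fin_op (rho l) (c l) x) <= l.+1%:R^-1 * lp_norm x.
Proof.
move=> Ar; set m := (r ^ q)%N; set y := _ - _.
have e0 : 0 <= l.+1%:R^-1 :> R by [].
apply: lp_norm_le; first by rewrite mulr_ge0// lp_norm_ge0.
rewrite -(lp_sum_translate (- m%:Z)) powRM ?lp_norm_ge0// EFinM -lp_normE.
rewrite -(lp_sum_translate (- m%:Z) x).
apply: (lp_sum_block p1 orbit_block_system e0) => i.
have yE : y (i - m%:Z) =
    \sum_(j <- orbit_block i) weight_prod a b (i - m%:Z) (j - m%:Z) m * orbit_coef i j * x (j - m%:Z)
    - (if (`|i - m%:Z|%N <= rho l)%N then
        \sum_(j <- irange (rho l)) c l (i - m%:Z) j * x j else 0).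
  rewrite /y lpB fin_opE; congr (_ - _).
  have := @iter_C_map_coord R k p p1 a b ha hb orbit_block orbit_coef orbit_op m x (i - m%:Z).
  by rewrite subrK; apply => z l'.
rewrite yE; have rhs0 : 0 <= l.+1%:R^-1 / (size (orbit_block i))%:R ^+ 2 *
    \sum_(j <- orbit_block i) modulus (x (j - m%:Z)) :> R.
  by rewrite !mulr_ge0// ?sumr_ge0 ?invr_ge0 ?exprn_ge0// => j _; exact: modulus_ge0.
(* Rows of the block attached to [r], where the two sides agree exactly. *)
have [ir|ir] := leqP `|i - m%:Z| (rho l).
  have ci : center i = Some (l, r) by exact: centerE.
  rewrite [X in modulus (X - _)](_ : _ =
      \sum_(j <- irange (rho l)) c l (i - m%:Z) j * x j) ?subrr ?modulus0//.
  rewrite /orbit_block /orbit_coef ci big_map; apply: eq_bigr => t _.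
  rewrite -/m (addrC m%:Z) addrK [_ * (_ / _)]mulrC divfK//.
  exact: weight_prod_neq0.
rewrite subr0; case ci : (center i) => [[l' n]|]; last first.
  by rewrite [X in modulus X](_ : _ = 0) ?modulus0// /orbit_block ci big_nil.
apply: (@block_row_le R k (orbit_block i)
  (fun j => weight_prod a b (i - m%:Z) (j - m%:Z) m * orbit_coef i j)
  (fun j => x (j - m%:Z)) _ e0) => j ji.
have [l2 [n2 [ci2 An In jn]]] := mem_orbit_block ji.
move: ci2; rewrite ci => -[? ?]; subst l2 n2.
have nr : n != r.
  apply: contraTneq ir => nr; subst n; rewrite -leqNgt.
  by rewrite (separated_set_disjoint gap_gt0 Ar An).
rewrite (size_orbit_block ci) /orbit_coef ci.
set i' := i - (n ^ q)%N%:Z in In *; set j' := j - (n ^ q)%N%:Z in jn *.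
rewrite [X in modulus X](_ : _ = c l' i' j' * transfer i' j' n r); last first.
  by rewrite -transferE !subrK mulrCA.
have hf := separated_far An Ar nr.
(* The gap of the larger of the two indices is used. *)
have [l'l|ll'] := leqP l' l.
  by apply: gap_small In jn => //; exact: far_mono (leq_addl _ _) hf.
apply: (@le_trans _ _ l'.+1%:R^-1).
  by apply: gap_small In jn => //; exact: far_mono (leq_addr _ _) hf.
by rewrite lef_pV2 ?posrE// ler_nat ltnS ltnW.
Qed.

End WithGap.
End Construction.

(** * Visits to all finite matrices *)

Lemma dense_scalars (R : realType) (k : scalar_kind) :
  exists d : nat -> scalar_field R k,
    forall z (e : R), 0 < e -> exists n, modulus (d n - z) < e.
Proof.
have near_rat (x e : R) : 0 < e -> exists r : rat, `|ratr r - x| < e.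
  move=> e0; have [|r] := @rat_in_itvoo R (x - e) (x + e); first lra.
  by rewrite in_itv/= => /andP[h1 h2]; exists r; rewrite ltr_norml; lra.
case: k => /=.
  exists (fun n => ratr (odflt 0 (unpickle n : option rat))) => z e /(near_rat z)[r hr].
  by exists (pickle r); rewrite pickleK.
exists (fun n => let r := odflt (0, 0) (unpickle n : option (rat * rat)) in
  (ratr r.1 +i* ratr r.2)%C) => -[x y] e e0.
have e20 : 0 < e / 2 by rewrite divr_gt0.
have [r hr] := near_rat x _ e20; have [r' hr'] := near_rat y _ e20.
exists (pickle (r, r')); rewrite pickleK /=.
rewrite (splitr e); apply: le_lt_trans (ltrD hr hr').
exact: sqrt_sqrD_le.
Qed.

Lemma inj_unbounded (f : nat -> nat) (L : nat) : injective f -> exists t, (L <= f t)%N.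
Proof.
move=> fi; apply: contrapT => h.
have lt t : (f t < L)%N by rewrite ltnNge; apply/negP => ?; apply: h; exists t.
have gi : injective (fun t : 'I_L.+1 => Ordinal (lt t)).
  by move=> t t' /(congr1 val)/= /fi/val_inj.
by have := leq_card _ gi; rewrite !card_ord ltnn.
Qed.

(** Each matrix with entries in the countable dense set is listed infinitely often
(the component [t] of the code is a mere label), so that the index [l], hence the
precision [1/(l + 1)], can be taken large.  The entries are stored in a list
addressed by the code of the pair [(i, j)]. *)
Lemma dense_matrices (R : realType) (k : scalar_kind) :
  exists (rho : nat -> nat) (c : nat -> int -> int -> scalar_field R k),
  forall n (c' : int -> int -> scalar_field R k) (e : R) L, 0 < e ->
    exists l, [/\ (L <= l)%N, rho l = n &
      forall i j, (`|i|%N <= n)%N -> (`|j|%N <= n)%N -> modulus (c l i j - c' i j) < e].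
Proof.
have [d dd] := dense_scalars R k.
pose code l := odflt (0%N, 0%N, [::]) (unpickle l : option (nat * nat * seq nat)).
exists (fun l => (code l).1.2), (fun l i j => d (nth 0%N (code l).2 (pickle (i, j)))).
move=> n c' e L e0.
have [g hg] := choice (fun ij : int * int => dd (c' ij.1 ij.2) e e0).
pose B := (\max_(ij <- [seq (i, j) | i <- irange n, j <- irange n]) pickle ij).+1.
pose s := mkseq (fun u => g (odflt (0, 0) (unpickle u))) B.
have [|t Lt] := @inj_unbounded (fun t => pickle (t, n, s)) L.
  by move=> t t' /(pcan_inj pickleK) [].
exists (pickle (t, n, s)); rewrite /code pickleK /=; split => // i j ii jj.
have uB : (pickle (i, j) < B)%N.
  rewrite ltnS; apply: (@leq_bigmax_seq _ _ xpredT (fun ij : int * int => pickle ij) (i, j)) => //.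
  by apply/allpairsP; exists (i, j); rewrite !mem_irange.
by rewrite nth_mkseq// pickleK; exact: (hg (i, j)).
Qed.

(** The quotients are eventually at least [1/(2 * P)]. *)
Lemma liminf_gt0 (R : realType) (u : nat -> nat) (P : nat) : (0 < P)%N ->
  (forall N, (N %/ P <= u N)%N) ->
  (0 < limn_einf (fun N => ((u N)%:R / N%:R : R)%:E))%E.
Proof.
move=> P0 hu; set v := fun N => _.
have d0 : 0 < (2 * P)%:R^-1 :> R by rewrite invr_gt0 ltr0n muln_gt0.
apply: (@lt_le_trans _ _ (2 * P)%:R^-1%:E); first by rewrite lte_fin.
rewrite limn_einf_lim (cvg_lim _ (cvg_einfs_sup (u := v)))//.
apply: (@le_trans _ _ (einfs v P)); last by apply: ereal_sup_ubound; exists P.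
apply: le_ereal_inf_tmp => _ [N /= PN <-]; rewrite /v lee_fin.
have N0 : (0 < N)%N := leq_trans P0 PN.
rewrite ler_pdivlMr ?ltr0n// mulrC ler_pdivrMr ?ltr0n ?muln_gt0// -natrM ler_nat.
have := hu N; have := leq_div2r P PN; rewrite divnn P0 => h1 h2.
have := ltn_ceil N P0; nia.
Qed.

Section Hits.
Context {R : realType} {k : scalar_kind} {p : R} {p1 : 1 <= p}.
Notation K := (scalar_field R k).
Notation X := (lp k p1).

Lemma lp_normrE (x : X) : `|x| = to_scalar (lp_norm x). Proof. by []. Qed.

Lemma lp_norm_triangle (x y z : X) :
  lp_norm (x - z) <= lp_norm (x - y) + lp_norm (y - z).
Proof. by rewrite -[x - z](subrKA y); exact: lp_normD. Qed.

Lemma opnorm_lp_le (T : bounded_op X) (e : R) : 0 <= e ->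
  (forall x, lp_norm (T x) <= e * lp_norm x) -> opnorm T <= e.
Proof.
move=> e0 h; apply: opnorm_le => x; rewrite !lp_normrE modulus_to_scalar ?lp_norm_ge0//.
rewrite -(@to_scalar1 R k) ler_to_scalar => x1; apply: le_trans (h x) _.
by rewrite ler_piMr.
Qed.

Lemma compact_op_nbhs (F : compact_op X) (V : set (compact_op X)) : nbhs F V ->
  exists2 e : R, 0 < e & forall T : compact_op X,
    (forall x, lp_norm (T x - F x) <= e * lp_norm x) -> V T.
Proof.
move=> /nbhs_normP[e /= e0 eV]; have [d d0 ed] := pos_to_scalar e0.
exists (d / 2); first by rewrite divr_gt0.
move=> T hT; apply: eV => /=; rewrite ed distrC [X in X < _]/(to_scalar _) ltr_to_scalar.
apply: le_lt_trans (_ : _ <= d / 2) _; last by rewrite ltr_pdivrMr// ltr_pMr// ltr1n.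
by apply: opnorm_lp_le => //; rewrite divr_ge0// ltW.
Qed.

Definition lower_density_gt0 (q : nat) (M : nat -> Prop) : Prop :=
  (0 < limn_einf (fun N : nat =>
      (#|[pred n : 'I_(N ^ q).+1 | (0 < n)%N && `[< M n >]]|%:R / N%:R : R)%:E))%E.

(** The map [r |-> r ^ q] turns the elements of [separated_set gap l] up to [N]
into times up to [N ^ q], which is how the lower density of this set becomes a lower
bound for the quotients with denominator [N]. *)
Lemma hitting_operator (q : nat) (a b : int -> K) (ha : bounded_seq a) (hb : bounded_seq b) :
  (0 < q)%N -> (forall n, a n != 0) -> (forall n, b n != 0) ->
  weights_grow q a b -> weights_decay q a b ->
  exists S : compact_op X, forall V : set (compact_op X), open V ->
    (exists n c, V (fin_op n c)) ->
    lower_density_gt0 q (fun m => V (iter m (C_cop (backward_shift p1 ha) (forward_shift p1 hb)) S)).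
Proof.
move=> q0 a0 b0 growth decay.
have [rho [c dense]] := dense_matrices R k.
have [gap hgap] := gap_exists rho c q0 growth decay.
have rho_gap l : (rho l < gap l)%N by case: (hgap l).
have gap_small := fun l => (hgap l).2.
have gap0 l : (0 < gap l)%N by exact: leq_ltn_trans (rho_gap l).
exists (orbit_op q0 growth decay rho_gap gap_small) => V oV [n [c' VF]].
have [e e0 hV] := compact_op_nbhs (open_nbhs_nbhs (conj oV VF)).
have sz0 : 0 < (n.*2.+1)%:R ^+ 2 :> R by rewrite exprn_gt0.
have [l [Ll rl hl]] := dense n c' (e / 2 / (n.*2.+1)%:R ^+ 2) (Num.truncn (e / 2)^-1).+1
  (divr_gt0 (divr_gt0 e0 (ltr0n _ 2)) sz0).
have e20 : 0 < e / 2 by rewrite divr_gt0.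
have le : l.+1%:R^-1 <= e / 2.
  rewrite -[e / 2]invrK lef_pV2 ?posrE ?invr_gt0//.
  by apply: ltW; apply: lt_trans (truncnS_gt _) _; rewrite ltr_nat ltnS.
have aux (u v w t : R) : u <= t * w -> v <= e / 2 * w -> t <= e / 2 -> 0 <= w -> u + v <= e * w.
  move=> uw vw te w0; rewrite (splitr e) mulrDl; apply: lerD => //.
  by apply: le_trans uw _; rewrite ler_wpM2r.
have hit r : separated_set gap l r -> V (iter (r ^ q)
    (C_cop (backward_shift p1 ha) (forward_shift p1 hb))
    (orbit_op q0 growth decay rho_gap gap_small)).
  move=> Ar; apply: hV => x; rewrite iter_C_cop.
  have h1 := orbit_op_hits (p1 := p1) q0 a0 b0 growth decay rho_gap gap_small ha hb x Ar.
  have h2 : lp_norm (fin_op (rho l) (c l) x - fin_op n c' x) <= e / 2 * lp_norm x.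
    rewrite rl; apply: fin_op_near (ltW e20) _ => i j ii jj.
    by rewrite mulrC -ler_pdivlMr//; exact/ltW/hl.
  exact: le_trans (lp_norm_triangle _ _ _) (aux _ _ _ _ h1 h2 le (lp_norm_ge0 x)).
have P0 : (0 < 2 ^ (level gap l + 3))%N by rewrite expn_gt0.
apply: liminf_gt0 P0 _ => N; apply: leq_trans (separated_set_dense gap0 l N) _.
have bd (r : 'I_N.+1) : (r ^ q < (N ^ q).+1)%N by rewrite ltnS leq_exp2r// -ltnS.
pose f (r : 'I_N.+1) : 'I_(N ^ q).+1 := Ordinal (bd r).
have fi : injective f.
  by move=> r r' /(congr1 val)/= /eqP; rewrite eqn_exp2r// => /eqP/val_inj.
rewrite -(card_imset _ fi); apply: subset_leq_card; apply/fintype.subsetP => _ /imsetP[r Ar ->].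
rewrite inE /=; have {}Ar : separated_set gap l r by [].
rewrite expn_gt0 (leq_trans (gap0 l) (separated_set_ge Ar)) /=.
by apply/asboolP; exact: hit.
Qed.

(** Open sets are pulled back along [h]: their preimages are open and, by density,
contain a finite matrix.  The hypothesis on [S] is restricted to open sets that
contain a finite matrix because these matrices are not dense among the compact
operators when [p = 1]. *)
Lemma q_frequently_hypercyclic_transfer (q : nat) (E : topologicalLmodType K)
    (A : E -> E) (C : compact_op X -> compact_op X) (h : compact_op X -> E) (S : compact_op X) :
  linear A -> continuous A -> continuous h -> (forall T, h (C T) = A (h T)) ->
  (forall V : set E, open V -> V !=set0 -> exists n c, V (h (fin_op n c))) ->
  (forall V : set (compact_op X), open V -> (exists n c, V (fin_op n c)) ->
    lower_density_gt0 q (fun m => V (iter m C S))) ->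
  q_frequently_hypercyclic q A.
Proof.
move=> lA cA ch hA dense hS; split => //; exists (h S) => V oV V0.
suff : lower_density_gt0 q (fun m => V (iter m A (h S))) by [].
have iterE m : iter m A (h S) = h (iter m C S) by elim: m => //= m ->; rewrite hA.
have -> : (fun m => V (iter m A (h S))) = (fun m => V (h (iter m C S))).
  by apply/funext => m; rewrite iterE.
apply: (hS (h @^-1` V)); last exact: dense.
by apply: open_comp => // x _; exact: ch.
Qed.

End Hits.

(** * Density for the strong and the compact-open topologies *)

Section Density.
Context {R : realType} {k : scalar_kind} {p : R} {p1 : 1 <= p}.
Notation K := (scalar_field R k).
Notation X := (lp k p1).
Implicit Types (T : bounded_op X) (x y : X).

(** The maps [y |-> y - trunc n y] do not increase norms and tend to zero pointwise,
hence uniformly on compact sets. *)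
Lemma compact_tails (A : set X) (e : R) : compact A -> 0 < e ->
  exists N, forall n y, (N <= n)%N -> A y -> lp_norm (y - trunc n y) < e.
Proof.
move=> cA e0.
have e20 : 0 < e / 2 by rewrite divr_gt0.
have /compact_near_coveringP/(_ nat \oo (fun n y => lp_norm (y - trunc n y) < e)) := cA.
case=> [x Ax|N _ hN]; last by exists N => n y Nn Ay; exact: (hN n Nn y Ay).
have [N hN] := trunc_cvg x e20.
exists ([set y | lp_norm (x - y) < e / 2], [set n | (N <= n)%N]).
  by split; [apply/lp_nbhsP; exists (e / 2) | exists N].
move=> [y n] [/= xy Nn].
have -> : y - trunc n y = (x - trunc n x) - ((x - y) - trunc n (x - y)).
  by rewrite [trunc n (x - y)]raddfB opprB addrA subrKA opprB addrC subrKA.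
rewrite (splitr e); apply: le_lt_trans (lp_normD _ _) _; apply: ltrD.
  exact: le_lt_trans (lp_norm_tail _ Nn) hN.
by rewrite -scaleN1r lp_normZ modulusN modulus1 mul1r (le_lt_trans (lp_norm_tail_le _ _)).
Qed.

Lemma compact_lp_bounded (A : set X) : compact A ->
  exists2 M : R, 0 < M & forall y, A y -> lp_norm y <= M.
Proof.
move=> cA.
have /compact_near_coveringP/(_ nat \oo (fun n y => lp_norm y < n%:R)) := cA.
case=> [x Ax|N _ hN]; last first.
  by exists N.+1%:R => // y Ay; apply: ltW; exact: (hN N.+1 (leqnSn N) y Ay).
exists ([set y | lp_norm (x - y) < 1], [set n | ((Num.truncn (lp_norm x + 1)).+1 <= n)%N]).
  by split; [apply/lp_nbhsP; exists 1 | exists (Num.truncn (lp_norm x + 1)).+1].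
move=> [y n] [/= xy Nn].
apply: lt_le_trans (_ : _ < (Num.truncn (lp_norm x + 1)).+1%:R) _; last by rewrite ler_nat.
apply: lt_trans (truncnS_gt _); rewrite -[y](subrK x) addrC.
apply: le_lt_trans (lp_normD _ _) _; rewrite ltrD2l -opprB -scaleN1r lp_normZ.
by rewrite modulusN modulus1 mul1r.
Qed.

Lemma bop_lp_bounded T : exists2 M : R, 0 < M & forall x, lp_norm (T x) <= M * lp_norm x.
Proof.
have [M M0 hM] := bop_bounded T; have [d d0 e] := pos_to_scalar M0.
by exists d => // x; have := hM x; rewrite !lp_normrE e -to_scalarM ler_to_scalar.
Qed.

(** The finite matrix [P_n T P_n], see [compressionE]. *)
Definition compression n T : compact_op X := fin_op n (fun i j => T (lp_basis j) i).

Lemma compressionE n T x : compression n T x = trunc n (T (trunc n x)).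
Proof.
apply/val_inj/funext => i; rewrite [LHS]fin_opE [RHS]truncE.
have TZ c y : T (c *: y) = c *: T y by rewrite linearZ.
case: ifP => // _; rewrite [trunc n x]trunc_basis raddf_sum lp_sum_coord.
by apply: eq_bigr => j _; rewrite mulrC -lpZ -TZ.
Qed.

Lemma compression_sub n T x :
  lp_norm (T x - compression n T x) <=
  lp_norm (T x - trunc n (T x)) + lp_norm (T (x - trunc n x)).
Proof.
rewrite compressionE; apply: le_trans (lp_norm_triangle _ (trunc n (T x)) _) _.
rewrite lerD2l (_ : _ - _ = trunc n (T (x - trunc n x))) ?lp_norm_trunc//.
by rewrite [T (x - _)]raddfB [RHS]raddfB.
Qed.

Lemma compression_cvg_compact T (A : set X) (e : R) : compact A -> 0 < e ->
  exists N, forall n y, (N <= n)%N -> A y -> lp_norm (T y - compression n T y) < e.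
Proof.
move=> cA e0; have [M M0 hM] := bop_lp_bounded T.
have e20 : 0 < e / 2 by rewrite divr_gt0.
have [N1 h1] := compact_tails cA (divr_gt0 e20 M0).
have cTA : compact (T @` A).
  by apply: continuous_compact => //; apply: continuous_subspaceT; exact: bop_continuous.
have [N2 h2] := compact_tails cTA e20.
exists (maxn N1 N2) => n y; rewrite geq_max => /andP[n1 n2] Ay.
apply: le_lt_trans (compression_sub _ _ _) _; rewrite (splitr e); apply: ltrD.
  by apply: h2 => //; exists y.
by apply: le_lt_trans (hM _) _; rewrite mulrC -ltr_pdivlMr//; exact: h1.
Qed.

Lemma lp_ltr_to_scalar x (e : R) : (`|x| < to_scalar e) = (lp_norm x < e).
Proof. by rewrite lp_normrE ltr_to_scalar. Qed.

Lemma sot_dense (V : set (sot X)) : open V -> V !=set0 ->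
  exists n c, V (cop_bop (fin_op n c)).
Proof.
move=> [W oW WV] [T]; rewrite -WV => WT.
have : {ptws, (fun n => (compression n T : X -> X)) @ \oo --> (T : X -> X)}.
  apply/pointwise_cvgP => x; apply/cvgrPdist_lt => e /pos_to_scalar[d d0 ->].
  have [N hN] := compression_cvg_compact T (@compact_set1 _ x) d0.
  by exists N => // n Nn /=; rewrite lp_ltr_to_scalar; exact: hN.
move=> /(_ W (open_nbhs_nbhs (conj oW WT)))[N _ hN].
by exists N, (fun i j => T (lp_basis j) i); exact: (hN N (leqnn N)).
Qed.

Lemma cot_dense (V : set (cot X)) : open V -> V !=set0 ->
  exists n c, V (cop_bop (fin_op n c)).
Proof.
move=> [W oW WV] [T]; rewrite -WV => WT.
have : {family compact, (fun n => (compression n T : X -> X)) @ \oo --> (T : X -> X)}.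
  apply/fam_cvgP => A cA U /uniform_nbhs[E [entE EU]].
  move: entE; rewrite -entourage_ballE => -[e /= e0 eE].
  have [d d0 ed] := pos_to_scalar e0.
  have [N hN] := compression_cvg_compact T cA d0.
  exists N => // n Nn; apply: EU => y Ay; apply: eE.
  by rewrite /= -ball_normE /= ed lp_ltr_to_scalar; exact: hN.
move=> /(_ W (open_nbhs_nbhs (conj oW WT)))[N _ hN].
by exists N, (fun i j => T (lp_basis j) i); exact: (hN N (leqnn N)).
Qed.

End Density.

(** * Continuity of the inclusions and of the conjugation maps *)

Section Continuity.
Context {R : realType} {k : scalar_kind} {p : R} {p1 : 1 <= p}.
Notation K := (scalar_field R k).
Notation X := (lp k p1).
Variables (A B : bounded_op X).

Lemma opnorm_lpP (T : bounded_op X) x : lp_norm (T x) <= opnorm T * lp_norm x.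
Proof. by have := opnormP T x; rewrite !lp_normrE -to_scalarM ler_to_scalar. Qed.

Lemma compact_op_near (T : compact_op X) (e : R) : 0 < e ->
  nbhs T [set T' : compact_op X | forall x, lp_norm (T x - T' x) <= e * lp_norm x].
Proof.
move=> e0; apply: (iffRL (@nbhs_normP _ (compact_op X) T _)).
exists (to_scalar e) => /=; first by rewrite -to_scalar0 ltr_to_scalar.
move=> T' /=; rewrite [X in X < _]/(to_scalar _) ltr_to_scalar => h x.
apply: le_trans (opnorm_lpP (T - T' : compact_op X) x) _.
by rewrite ler_wpM2r ?lp_norm_ge0// ltW.
Qed.

Lemma C_cop_linear : linear (C_cop A B).
Proof. by move=> c S T; apply/val_inj; exact: C_map_linear. Qed.

Lemma C_cop_continuous : continuous (C_cop A B).
Proof.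
move=> T U /compact_op_nbhs[e e0 eU].
have [M M0 hM] := bop_lp_bounded A; have [N N0 hN] := bop_lp_bounded B.
have MN0 : 0 < M * N by rewrite mulr_gt0.
apply: filterS (compact_op_near T (divr_gt0 e0 MN0)) => T' h; apply: eU => x.
have -> : C_cop A B T' x - C_cop A B T x = - A (T (B x) - T' (B x)).
  by rewrite raddfB opprB.
rewrite -scaleN1r lp_normZ modulusN modulus1 mul1r.
apply: le_trans (hM _) _; apply: le_trans (ler_wpM2l (ltW M0) (h (B x))) _.
apply: le_trans (_ : _ <= M * (e / (M * N) * (N * lp_norm x))) _.
  by rewrite !ler_wpM2l ?(ltW M0)// divr_ge0 ?ltW.
have -> : M * (e / (M * N) * (N * lp_norm x)) = e * lp_norm x; last by [].
by field; rewrite !gt_eqF.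
Qed.

Lemma C_map_sot_continuous : continuous (C_map A B : sot X -> sot X).
Proof.
apply: sot_continuous => x S.
apply: (@continuous_comp (sot X) X X (fun S => (S : bounded_op X) (B x)) A).
  exact: sot_eval.
exact: bop_continuous.
Qed.

Lemma C_map_cot_continuous : continuous (C_map A B : cot X -> cot X).
Proof.
apply: cot_continuous => S D e cD e0.
have [M M0 hM] := bop_bounded A.
have cBD : compact (B @` D).
  by apply: continuous_compact => //; apply: continuous_subspaceT; exact: bop_continuous.
apply: filterS (cot_nbhs S cBD (divr_gt0 e0 M0)) => S' /= h y Dy.
have -> : A (S (B y)) - A (S' (B y)) = A (S (B y) - S' (B y)) by rewrite raddfB.
by apply: le_lt_trans (hM _) _; rewrite mulrC -ltr_pdivlMr//; apply: h; exists y.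
Qed.

Lemma compact_op_sot_continuous : continuous (fun T : compact_op X => (T : bounded_op X) : sot X).
Proof.
apply: sot_continuous => x T U /lp_nbhsP[d d0 dU].
have x1 : 0 < lp_norm x + 1 by rewrite ltr_wpDl// lp_norm_ge0.
apply: filterS (compact_op_near T (divr_gt0 d0 x1)) => T' h; apply: dU.
apply: le_lt_trans (h x) _; rewrite -mulrA gtr_pMr// mulrC ltr_pdivrMr//.
by rewrite mul1r ltrDl.
Qed.

Lemma compact_op_cot_continuous : continuous (fun T : compact_op X => (T : bounded_op X) : cot X).
Proof.
apply: cot_continuous => T D e cD /pos_to_scalar[d d0 ->].
have [M M0 hM] := compact_lp_bounded cD.
have d20 : 0 < d / 2 by rewrite divr_gt0.
apply: filterS (compact_op_near T (divr_gt0 d20 M0)) => T' h y Dy.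
rewrite lp_ltr_to_scalar; apply: le_lt_trans (h y) _.
apply: le_lt_trans (_ : _ <= d / 2) _; last by rewrite ltr_pdivrMr// ltr_pMr// ltr1n.
by rewrite mulrC mulrA ler_pdivrMr// mulrC ler_wpM2l ?(ltW d20)// hM.
Qed.

End Continuity.

(** * Density for the operator norm *)

Lemma lt_of_split (R : realFieldType) (u v w z : R) :
  u <= v + w -> v < u - z -> z < w.
Proof. lra. Qed.

Section FunctionalTails.
Context {R : realType} {k : scalar_kind} {p : R} (p1 : 1 < p).
Notation K := (scalar_field R k).
Notation X := (lp k (ltW p1)).
Variables (phi : X -> K^o) (M : R).
Implicit Types x y : X.
Hypothesis phiB : forall x y, phi (x + y) = phi x + phi y.
Hypothesis phiZ : forall c x, phi (c *: x) = c * phi x.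
Hypothesis phiM : forall x, modulus (phi x) <= M * lp_norm x.

Let p0 : 0 < p. Proof. exact: lt_trans p1. Qed.

Let theta : R := 2 `^ p^-1 / 2.

Definition tail_bound (n : nat) (d : R) : Prop :=
  forall x, (forall i, (`|i|%N <= n)%N -> x i = 0) -> modulus (phi x) <= d * lp_norm x.

(** This is where [p > 1] is used: two unit vectors with disjoint supports have a
sum of norm [2 `^ p^-1], which is smaller than [2]. *)
Lemma theta_bounds : 0 < theta < 1.
Proof.
rewrite divr_gt0 ?powR_gt0//= ltr_pdivrMr// mul1r.
have r0 : 0 < 1 - p^-1 by rewrite subr_gt0 invf_lt1.
have := gt0_ltr_powR r0 (x := 1) (y := 2); rewrite !nnegrE => /(_ ler01 (ler0n _ 2) (ltr1n _ 2)).
rewrite powR1 => h; rewrite -[ltRHS](@powRr1 _ 2)// -[X in _ < _ `^ X](subrKC p^-1 1).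
by rewrite powRD ?pnatr_eq0 ?implybT// ltr_pMr// powR_gt0.
Qed.

(** Divide by the norm and rotate the phase. *)
Lemma normalize_functional x (t : R) : 0 <= t -> t * lp_norm x < modulus (phi x) ->
  exists (c : K) (s : R), [/\ lp_norm (c *: x) = 1, phi (c *: x) = to_scalar s & t < s].
Proof.
move=> t0 tx.
have fx : 0 < modulus (phi x) by apply: le_lt_trans tx; rewrite mulr_ge0 ?lp_norm_ge0.
have nx : 0 < lp_norm x.
  rewrite lt_def lp_norm_ge0 andbT; apply: contraTneq fx => nx.
  by rewrite -leNgt (le_trans (phiM x))// nx mulr0.
have f0 : phi x != 0 by rewrite -modulus_gt0.
exists (to_scalar (modulus (phi x) / lp_norm x) / phi x), (modulus (phi x) / lp_norm x).
split; last by rewrite ltr_pdivlMr.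
  rewrite lp_normZ modulusM modulusV modulus_to_scalar ?divr_ge0 ?ltW//.
  by field; rewrite !gt_eqF.
by rewrite phiZ divfK.
Qed.

(** If the bound could not be improved beyond any [n'], there would be two unit
vectors [x] and [y] with disjoint supports outside [[-n, n]] on which [phi] is larger
than [theta * d].  Then [phi (x + y) > 2 * theta * d], while [x + y] has norm
[2 `^ p^-1], which contradicts the bound [d] by the choice of [theta]. *)
Lemma tail_bound_step n d : 0 < d -> tail_bound n d ->
  exists n', tail_bound n' (theta * d).
Proof.
move=> d0 hd; apply: contrapT => no.
have [th0 _] := andP theta_bounds.
have td0 : 0 <= theta * d by rewrite mulr_ge0 ?ltW.
have ex m : exists x : X, (forall i, (`|i|%N <= m)%N -> x i = 0) /\
    theta * d * lp_norm x < modulus (phi x).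
  apply: contrapT => h; apply: no; exists m => x hx; rewrite leNgt; apply/negP => lt.
  by apply: h; exists x.
have [x0 [x0n hx0]] := ex n.
(* Cut [x0] off to a finite support, which leaves room for the second vector. *)
have [n' hn'] : exists n', theta * d * lp_norm (trunc n' x0) < modulus (phi (trunc n' x0)).
  pose g := modulus (phi x0) - theta * d * lp_norm x0.
  have g0 : 0 < g by rewrite subr_gt0.
  have M1 : 0 < `|M| + 1 by rewrite ltr_wpDl.
  have [n' hn'] := trunc_cvg x0 (divr_gt0 g0 M1).
  exists n'; apply: le_lt_trans (ler_wpM2l td0 (lp_norm_trunc n' x0)) _.
  have h1 : modulus (phi x0) <= modulus (phi (x0 - trunc n' x0)) + modulus (phi (trunc n' x0)).
    by rewrite -{1}(subrK (trunc n' x0) x0) (phiB (x0 - _)); exact: modulusD.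
  have h2 : modulus (phi (x0 - trunc n' x0)) < g.
    apply: le_lt_trans (phiM _) _.
    apply: le_lt_trans (_ : _ <= (`|M| + 1) * lp_norm (x0 - trunc n' x0)) _.
      by rewrite ler_wpM2r ?lp_norm_ge0// (le_trans (ler_norm _))// lerDl.
    by rewrite mulrC -ltr_pdivlMr.
  exact: lt_of_split h1 h2.
have [y0 [y0n hy0]] := ex (maxn n n').
have [c [s [cx fx ts]]] := normalize_functional td0 hn'.
have [c' [s' [cy fy ts']]] := normalize_functional td0 hy0.
set x := c *: trunc n' x0 in cx fx; set y := c' *: y0 in cy fy.
have xn i : (`|i|%N <= n)%N -> x i = 0.
  by move=> ii; rewrite /x lpZ truncE x0n// if_same mulr0.
have yn i : (`|i|%N <= maxn n n')%N -> y i = 0 by move=> ii; rewrite /y lpZ y0n// mulr0.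
have xy2 : lp_norm (x + y) = 2 `^ p^-1.
  have := @lp_norm_disjoint R k p (ltW p1) x y.
  rewrite cx cy powR1 => h.
  have {}h : lp_norm (x + y) `^ p = 2.
    apply: h => i; have [ii|ii] := leqP `|i| (maxn n n'); first by right; exact: yn.
    left; rewrite /x lpZ truncE leqNgt (leq_ltn_trans (leq_maxr n n') ii) mulr0 //.
  by rewrite -h -powRrM mulfV ?gt_eqF// powRr1// lp_norm_ge0.
have := hd (x + y).
have fxy : phi (x + y) = to_scalar (s + s') by rewrite phiB fx fy to_scalarD.
rewrite fxy modulus_to_scalar ?addr_ge0 ?(le_trans td0) ?(ltW ts) ?(ltW ts')//.
have xyn i : (`|i|%N <= n)%N -> (x + y) i = 0.
  by move=> ii; rewrite -[LHS]/(x i + y i) xn// yn ?addr0// (leq_trans ii)// leq_maxl.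
rewrite xy2 => /(_ xyn).
have -> : d * 2 `^ p^-1 = theta * d + theta * d by rewrite /theta; field.
by rewrite leNgt ltrD.
Qed.

(** Iterate [tail_bound_step] from the trivial bound; [theta ^+ m] tends to
zero. *)
Lemma functional_tails (e : R) : 0 < e -> exists n, tail_bound n e.
Proof.
move=> e0; have [th0 th1] := andP theta_bounds.
have M1 : 0 < `|M| + 1 by rewrite ltr_wpDl.
have H m : exists n, tail_bound n (theta ^+ m * (`|M| + 1)).
  elim: m => [|m [n hn]].
    exists 0%N => x _; rewrite expr0 mul1r; apply: le_trans (phiM _) _.
    by rewrite ler_wpM2r ?lp_norm_ge0// (le_trans (ler_norm _))// lerDl.
  have [|n' hn'] := tail_bound_step _ hn; first by rewrite mulr_gt0// exprn_gt0.
  by exists n'; rewrite exprS -mulrA.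
have [m hm] : exists m, theta ^+ m * (`|M| + 1) <= e.
  have : (fun m => theta ^+ m) @ \oo --> (0 : R) by apply: cvg_expr; rewrite gtr0_norm.
  move=> /cvgrPdist_le/(_ (e / (`|M| + 1)) (divr_gt0 e0 M1))[m _ /(_ m (leqnn m))].
  rewrite sub0r normrN ger0_norm ?exprn_ge0 ?(ltW th0)// ler_pdivlMr// => h.
  by exists m.
have [n hn] := H m; exists n => x xn; apply: le_trans (hn x xn) _.
by rewrite ler_wpM2r// lp_norm_ge0.
Qed.

End FunctionalTails.

Section CompactDensity.
Context {R : realType} {k : scalar_kind} {p : R} (p1 : 1 < p).
Notation K := (scalar_field R k).
Notation X := (lp k (ltW p1)).

Lemma compact_op_tails (T : compact_op X) (e : R) : 0 < e ->
  exists m, forall x : X, lp_norm (T x - trunc m (T x)) <= e * lp_norm x.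
Proof.
move=> e0; have /asboolP := cop_bopP T; rewrite precompactE => cT.
have [m hm] := compact_tails cT e0; exists m => x.
pose D : bounded_op X := (T : bounded_op X) - bop_comp (trunc m) T.
apply: le_trans (opnorm_lpP D x) _; rewrite ler_wpM2r ?lp_norm_ge0//.
apply: opnorm_le => y y1; rewrite lp_normrE modulus_to_scalar ?lp_norm_ge0//.
by apply/ltW/hm => //; apply: subset_closure; exists y.
Qed.

(** The compact operator [T] is close to [P_m T], which is given by the finitely
many functionals [x |-> T x i]; all of them have small tails, and therefore so
does [T]. *)
Lemma compression_cvg_opnorm (T : compact_op X) (e : R) : 0 < e ->
  exists n, forall x, lp_norm (compression n T x - T x) <= e * lp_norm x.
Proof.
move=> e0; have e30 : 0 < e / 3 by rewrite divr_gt0.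
have [m hm] := compact_op_tails T e30.
have m0 : 0 < (m.*2.+1)%:R :> R by rewrite ltr0n.
have [M M0 hM] := bop_lp_bounded T.
pose Q (i : int) n := tail_bound (fun x : X => T x i) n (e / 3 / (m.*2.+1)%:R).
have [||n hn] := @uniform_bound _ (irange m) Q.
- move=> i n n' nn' h x x0; apply: h => j jn; apply: x0; exact: leq_trans jn nn'.
- move=> i; apply: (@functional_tails R k p p1 (fun x => T x i) M); last exact: divr_gt0.
  + by move=> x y; rewrite raddfD.
  + by move=> c x; rewrite linearZ.
  + by move=> x; apply: le_trans (lp_coord_le _ _) (hM x).
pose N := maxn m n; exists N => x.
have tT (y : X) : (forall i, (`|i|%N <= N)%N -> y i = 0) ->
    lp_norm (T y) <= (e / 3 + e / 3) * lp_norm y.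
  move=> y0; rewrite -[T y](subrK (trunc m (T y))) mulrDl.
  apply: le_trans (lp_normD _ _) _; apply: lerD; first exact: hm.
  apply: le_trans (lp_norm_trunc_sum _ _) _.
  apply: (@le_trans _ _ (\sum_(i <- irange m) e / 3 / (m.*2.+1)%:R * lp_norm y)).
    rewrite big_seq [leRHS]big_seq; apply: ler_sum => i ii; apply: hn => // j jn.
    by apply: y0; rewrite (leq_trans jn)// leq_maxr.
  by rewrite sumr_const_seq size_irange -[leLHS]mulr_natr mulrAC divfK// gt_eqF.
rewrite -opprB -scaleN1r lp_normZ modulusN modulus1 mul1r.
apply: le_trans (compression_sub _ _ _) _.
have -> : e = e / 3 + (e / 3 + e / 3) by field.
rewrite mulrDl; apply: lerD.
  by apply: le_trans (lp_norm_tail _ _) (hm x); exact: leq_maxl.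
apply: le_trans (tT _ _) _; first by move=> i ii; rewrite tailE ii.
by apply: ler_wpM2l; [rewrite addr_ge0// ltW|exact: lp_norm_tail_le].
Qed.

Lemma compact_op_dense (V : set (compact_op X)) : open V -> V !=set0 ->
  exists n c, V (fin_op n c).
Proof.
move=> oV [T VT]; have [e e0 eV] := compact_op_nbhs (open_nbhs_nbhs (conj oV VT)).
have [n hn] := compression_cvg_opnorm T e0.
by exists n, (fun i j => T (lp_basis j) i); exact: eV.
Qed.

End CompactDensity.

(** * The theorem *)

Lemma weight_growth (R : realType) (k : scalar_kind) (q : nat)
    (a b : int -> scalar_field R k) : (0 < q)%N ->
  (forall n, a n != 0) -> (forall n, b n != 0) ->
  (forall (i j : int) (M : R), \forall n \near \oo, forall r : nat,
    let s : int := ((n + r) ^ q - r ^ q)%N%:Z in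
    1 <= s + i -> 1 <= s + j ->
    M < modulus (prod_up a (s + i) * prod_up b (s + j))) ->
  weights_grow q a b.
Proof.
move=> q0 a0 b0 h i j M; have [C C0 hC] := weight_prod_up a0 b0 i j.
have [N _ hN] := h i (j - 1) (M / C).
exists (maxn N (maxn `|i|.+1 `|j - 1|.+1)) => n r.
rewrite !geq_max => /and3P[Nn inn jn].
have ns : (n <= (n + r) ^ q - r ^ q)%N.
  by have := expn_diff q0 (leq_addl n r); rewrite addnK; lia.
have si := leq_trans inn ns; have sj := leq_trans jn ns.
rewrite hC// mulrC -ltr_pdivrMr//; apply: (hN n Nn r); lia.
Qed.

Lemma weight_decay (R : realType) (k : scalar_kind) (q : nat)
    (a b : int -> scalar_field R k) :
  (forall (i j : int) (eps : R), 0 < eps ->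
    \forall n \near \oo, forall r : nat, (n <= r)%N ->
    let l : nat := (r ^ q - (r - n) ^ q)%N in
    modulus (prod_down a i l * prod_down b j l) < eps) ->
  weights_decay q a b.
Proof.
move=> h i j e e0; have [N _ hN] := h i (j - 1) e e0.
exists N => n r Nn nr /=; rewrite weight_prod_down; exact: (hN n Nn r nr).
Qed.

Theorem proposition3p11 (R : realType) (k : scalar_kind) (q : nat)
    (a b : int -> scalar_field R k) (ha : bounded_seq a) (hb : bounded_seq b) :
  (0 < q)%N ->
  (forall n, a n != 0) -> (forall n, b n != 0) ->
  (forall (i j : int) (M : R), \forall n \near \oo, forall r : nat,
    let s : int := ((n + r) ^ q - r ^ q)%N%:Z in
    1 <= s + i -> 1 <= s + j ->
    M < modulus (prod_up a (s + i) * prod_up b (s + j))) ->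
  (forall (i j : int) (eps : R), 0 < eps ->
    \forall n \near \oo, forall r : nat, (n <= r)%N ->
    let l : nat := (r ^ q - (r - n) ^ q)%N in
    modulus (prod_down a i l * prod_down b j l) < eps) ->
  q_frequently_hypercyclic q (E := sot (lp k (lexx 1)))
    (C_map (backward_shift (lexx 1) ha) (forward_shift (lexx 1) hb)) /\
  (forall (p : R) (p1 : 1 < p),
    q_frequently_hypercyclic q (E := compact_op (lp k (ltW p1)))
      (C_cop (backward_shift (ltW p1) ha) (forward_shift (ltW p1) hb)) /\
    q_frequently_hypercyclic q (E := cot (lp k (ltW p1)))
      (C_map (backward_shift (ltW p1) ha) (forward_shift (ltW p1) hb))).
Proof.
move=> q0 a0 b0 up down.
have growth := weight_growth q0 a0 b0 up; have decay := weight_decay down.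
split=> [|p p1].
  have [S hS] := hitting_operator (p1 := lexx 1) ha hb q0 a0 b0 growth decay.
  apply: (q_frequently_hypercyclic_transfer
    (h := fun T : compact_op _ => (T : bounded_op _) : sot _) (S := S) _ _ _ _ _ hS) => //.
  - exact: C_map_linear.
  - exact: C_map_sot_continuous.
  - exact: compact_op_sot_continuous.
  - exact: sot_dense.
have [S hS] := hitting_operator (p1 := ltW p1) ha hb q0 a0 b0 growth decay.
split.
  apply: (q_frequently_hypercyclic_transfer (h := id) (S := S) _ _ _ _ _ hS) => //.
  - exact: C_cop_linear.
  - exact: C_cop_continuous.
  - by move=> T; exact: cvg_id.
  - exact: compact_op_dense.
apply: (q_frequently_hypercyclic_transfer
  (h := fun T : compact_op _ => (T : bounded_op _) : cot _) (S := S) _ _ _ _ _ hS) => //.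
- exact: C_map_linear.
- exact: C_map_cot_continuous.
- exact: compact_op_cot_continuous.
- exact: cot_dense.
Qed.
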